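(* There is no finite planar map with straight edges of equal length that is regular of degree $5$. That is, there do not exist a finite nonempty set $V$ of points in the Euclidean plane $\mathbb{R}^2$ and a set $E$ of closed straight line segments, each joining two distinct points of $V$, such that: (i) all segments in $E$ have the same length; (ii) any two distinct segments in $E$ intersect in at most one point, and that point, if it exists, is a common endpoint of both; (iii) no point of $V$ lies in the relative interior of a segment of $E$; and (iv) every point of $V$ is an endpoint of exactly $5$ segments of $E$.
   Context: A planar map with straight edges is a finite graph drawn in the plane with vertices as distinct points and edges as straight line segments between their endpoints, such that edges do not cross or overlap (two edges meet at most in a common endpoint, and no vertex lies in the interior of an edge). Such a configuration with all edges of equal length is sometimes called a match-stick graph. Regular of degree $5$ means each vertex is on exactly $5$ edges. *)

(* Defs.v *)
From HB Require Import structures.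
From mathcomp Require Import all_boot all_order all_algebra.
From mathcomp Require Import all_classical all_reals.

Set Implicit Arguments.
Unset Strict Implicit.
Unset Printing Implicit Defensive.

Import Order.TTheory GRing.Theory Num.Theory.

Local Open Scope classical_set_scope.
Local Open Scope ring_scope.

Section Plane.
Variable R : realType.

Definition plane : Type := (R * R)%type.

Implicit Types (a b p : plane) (s : set plane).

(* Not the library norm on R * R, which is the sup norm. *)
Definition edist a b : R :=
  Num.sqrt ((a.1 - b.1) ^+ 2 + (a.2 - b.2) ^+ 2).

Definition seg_point a b (t : R) : plane :=
  ((1 - t) * a.1 + t * b.1, (1 - t) * a.2 + t * b.2).

Definition segment a b : set plane :=
  [set seg_point a b t | t in [set t : R | 0 <= t <= 1]].

Definition open_segment a b : set plane :=
  [set seg_point a b t | t in [set t : R | 0 < t < 1]].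

(* A segment is a set of points; as a nondegenerate segment determines its
   endpoints up to order, [joins s a b] holds for exactly two ordered pairs
   (a, b) when s is such a segment. *)
Definition joins s a b : Prop := a <> b /\ s = segment a b.

Definition endpoint p s : Prop := exists q, joins s p q.

Definition in_relint p s : Prop :=
  exists a b, joins s a b /\ open_segment a b p.


Definition straight_planar_map (V : set plane) (E : set (set plane)) : Prop :=
  [/\ finite_set V,
      forall s, E s -> exists a b, [/\ V a, V b & joins s a b],
      forall s t, E s -> E t -> s <> t ->
        is_subset1 (s `&` t) /\
        (forall x, (s `&` t) x -> endpoint x s /\ endpoint x t)
    & forall p s, V p -> E s -> ~ in_relint p s].

Definition equal_edges (E : set (set plane)) : Prop :=
  exists l : R, forall s a b, E s -> joins s a b -> edist a b = l.

Definition regular_of_degree (d : nat) (V : set plane)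
    (E : set (set plane)) : Prop :=
  forall p, V p -> ([set s | E s /\ endpoint p s] #= `I_d)%card.

End Plane.

(* Main.v *)
Require Import Defs.
From mathcomp Require Import all_boot all_order all_algebra.
From mathcomp Require Import all_classical all_reals.
From mathcomp Require Import trigo.
From mathcomp Require Import zify ring lra.

(** Discharging with angles.  Give a corner of angle [alpha] the excess
    [3 alpha / pi - 1]; the excesses at a vertex of degree [d] add up to [6 - d].
    Truncate the excess of every corner to [[0, 1]], calling the result the gift
    of the corner: if [d >= 5], the gifts at a vertex add up to at least the
    excesses.  On the other hand, in a face with [k] corners and angle sum at
    least [(k - 2) pi] the gifts add up to at most the excesses, whose sum is at
    least [2 k - 6].  This is clear when no angle is below [pi / 3]; a corner with
    a smaller angle has gift 0, so otherwise the gifts add up to at most [k - 1],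
    which is enough when [k >= 5], while for [k = 4] (a rhombus) small angles come
    in opposite pairs, and a triangle has no small angle.  On the unbounded face
    the inequality is strict, a contradiction.

    That a face with [k] corners has angle sum at least [(k - 2) pi], and at least
    [(k + 2) pi] if unbounded, is proved by sweeping a vertical line over the
    drawing.  The edge sides are labelled along the way: a gap of the sweep line
    opening at a vertex gets a fresh label, two gaps that merge at a vertex get
    their labels identified.  The turning number of a label class is the number
    of openings minus the number of merges, hence at most 1.  Label classes are
    unions of face boundaries and replace faces throughout, so neither the Jordan
    curve theorem nor Euler's formula is needed. *)

Set Implicit Arguments.
Unset Strict Implicit.
Unset Printing Implicit Defensive.

Import Order.TTheory GRing.Theory Num.Theory.

(** * Sequences and sums *)

Section SortBy.
Variables (disp : Order.disp_t) (K : orderType disp) (T : eqType) (f : T -> K).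
Implicit Types s t : seq T.

Definition key_lt : rel T := relpre f <%O.
Definition sort_by : seq T -> seq T := sort (relpre f <=%O).

Lemma key_lt_trans : transitive key_lt.
Proof. by move=> b a c; apply: lt_trans. Qed.

Lemma key_lt_sorted_uniq s : sorted key_lt s -> uniq s.
Proof. by rewrite -sorted_map => /lt_sorted_uniq/map_uniq. Qed.

Lemma sort_by_sorted s : {in s &, injective f} -> uniq s -> sorted key_lt (sort_by s).
Proof. by move=> injf us; rewrite -sorted_map -sort_map sort_lt_sorted map_inj_in_uniq. Qed.

Lemma sort_by_eq s t : uniq s -> s =i t -> sorted key_lt t -> sort_by s = t.
Proof.
move=> us st tS; have ut := key_lt_sorted_uniq tS.
have pst : perm_eq s t by apply: uniq_perm.
have sS : sorted key_lt (sort_by s).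
  rewrite -sorted_map -sort_map sort_lt_sorted (perm_uniq (perm_map f pst)).
  by apply: lt_sorted_uniq; rewrite sorted_map.
apply: (irr_sorted_eq key_lt_trans _ sS tS) => a; first exact: ltxx.
by rewrite mem_sort st.
Qed.

End SortBy.

Lemma notin_nil (T : eqType) (s : seq T) : (forall a, a \notin s) -> s = [::].
Proof. by case: s => // a s /(_ a); rewrite mem_head. Qed.

Lemma last_in (T : eqType) (z : T) (s : seq T) : s != [::] -> last z s \in s.
Proof. by case: s => //= a s _; rewrite mem_last. Qed.

Lemma next_cat (T : eqType) (s1 s2 : seq T) a :
  uniq (s1 ++ a :: s2) -> next (s1 ++ a :: s2) a = head a (s2 ++ s1).
Proof.
move=> us; rewrite -(next_rot (size s1) us) rot_size_cat /=.
by case: (s2 ++ s1) => [|b s] /=; rewrite eqxx.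
Qed.

Lemma next_key_lt disp (K : orderType disp) (T : eqType) (f : T -> K) (z : T) s a :
  sorted (key_lt f) s -> 1 < size s -> a \in s ->
  if a == last z s then key_lt f (next s a) a else key_lt f a (next s a).
Proof.
move=> sS + sa; have us := key_lt_sorted_uniq sS; move: us sS.
case/splitPr: sa => s1 s2 us; rewrite next_cat // last_cat.
rewrite (sorted_pairwise (@key_lt_trans _ _ _ f)) pairwise_cat => /and3P[/allrelP s12 _].
case: s2 us s12 => [|b s2] us s12 /=.
  by case: s1 s12 {us} => //= c s1 s12 _ _; rewrite eqxx s12 // mem_head.
move=> /andP[/andP[ab _] _] _; rewrite ifN //.
move: us; rewrite cat_uniq => /and3P[_ _] /andP[].
by move=> /memPnC/(_ (last b s2)); rewrite mem_last eq_sym => /(_ isT).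
Qed.

Lemma sum_count (R : pzSemiRingType) (I : Type) (s : seq I) (a : pred I) :
  (\sum_(i <- s) (a i)%:R = (count a s)%:R :> R)%R.
Proof.
by rewrite -sum1_count natr_sum [RHS]big_mkcond; apply: eq_bigr => i _; case: (a i).
Qed.

Lemma sumr1_size (R : pzSemiRingType) (I : Type) (s : seq I) :
  (\sum_(i <- s) 1 = (size s)%:R :> R)%R.
Proof. by rewrite big_const_seq count_predT iter_addr_0. Qed.

Lemma sum_by_label (R : nmodType) (I : eqType) (s : seq I) (lab : I -> nat) M (F : I -> R) :
  {in s, forall i, lab i < M} ->
  (\sum_(i <- s) F i = \sum_(c < M) \sum_(i <- [seq i <- s | lab i == c]) F i)%R.
Proof.
move=> labM; under [RHS]eq_bigr do rewrite big_filter big_mkcond.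
rewrite exchange_big /= big_seq [RHS]big_seq; apply: eq_bigr => i /labM iM.
by rewrite -big_mkcond (big_pred1 (Ordinal iM)) // => c; rewrite -val_eqE /= eq_sym.
Qed.

Section Clamp.
Variable R : realDomainType.
Local Open Scope ring_scope.
Implicit Type a : R.

Definition clamp01 a : R := Num.min 1 (Num.max 0 a).

Lemma clamp01_le1 a : clamp01 a <= 1.
Proof. by rewrite ge_min lexx. Qed.

Lemma clamp01_ge0 a : 0 <= clamp01 a.
Proof. by rewrite le_min ler01 le_max lexx. Qed.

Lemma clamp01_le a : 0 <= a -> clamp01 a <= a.
Proof. by move=> a_ge0; rewrite /clamp01 max_r // ge_min lexx orbT. Qed.

Lemma clamp01_ge a : a <= 1 -> a <= clamp01 a.
Proof. by move=> a_le1; rewrite le_min a_le1 le_max lexx orbT. Qed.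

Lemma clamp01_eq0 a : a <= 0 -> clamp01 a = 0.
Proof. by move=> a_le0; rewrite /clamp01 max_l // min_r. Qed.

Lemma clamp01_eq1 a : 1 <= a -> clamp01 a = 1.
Proof. by move=> a_ge1; rewrite /clamp01 min_l // le_max a_ge1 orbT. Qed.

Lemma sum_clamp01_ge (I : eqType) (s : seq I) (F : I -> R) :
  \sum_(i <- s) F i <= 1 -> \sum_(i <- s) F i <= \sum_(i <- s) clamp01 (F i).
Proof.
move=> sum_le1; have [/hasP[i si Fi_ge1]|/hasPn lt1] := boolP (has (fun i => 1 <= F i) s).
  apply: le_trans sum_le1 _; rewrite (big_rem i si) /= clamp01_eq1 // lerDl.
  by apply: sumr_ge0 => j _; apply: clamp01_ge0.
rewrite big_seq [leRHS]big_seq; apply: ler_sum => i /lt1.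
by rewrite -ltNge => /ltW; apply: clamp01_ge.
Qed.

End Clamp.

(* The labels met when crossing the edges s upwards, from c to c': the side of e
   below it carries lo e, the one above it up e. *)
Fixpoint chain (T : Type) (L : eqType) (lo up : T -> L) (c : L) s (c' : L) : bool :=
  if s is e :: s' then (lo e == c) && chain lo up (up e) s' c' else c == c'.

Section ChainTheory.
Variables (T : Type) (L : eqType).
Implicit Types (lo up : T -> L) (s : seq T) (c : L).

Lemma chain_cat lo up c s1 s2 c' :
  reflect (exists2 m, chain lo up c s1 m & chain lo up m s2 c')
          (chain lo up c (s1 ++ s2) c').
Proof.
elim: s1 c => [|e s1 IH] c /=.
  by apply: (iffP idP) => [h|[m /eqP->]//]; exists c.
by apply: (iffP andP) => [[-> /IH[m h1 h2]]|[m /andP[-> h1] h2]];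
  [exists m | split=> //; apply/IH; exists m].
Qed.

Lemma chain_map (T' : Type) (f : T' -> T) lo up c (s : seq T') c' :
  chain lo up c (map f s) c' = chain (lo \o f) (up \o f) c s c'.
Proof. by elim: s c => //= e s IH c; rewrite IH. Qed.

Lemma chain_relabel (L' : eqType) (rho : L -> L') lo up c s c' :
  chain lo up c s c' -> chain (rho \o lo) (rho \o up) (rho c) s (rho c').
Proof. by elim: s c => [|e s IH] c /= => [/eqP->|/andP[/eqP-> /IH->]]; rewrite eqxx. Qed.

Lemma chain_rev lo up c s c' : chain lo up c s c' -> chain up lo c' (rev s) c.
Proof.
elim: s c => [|e s IH] c /=; first by rewrite eq_sym.
move=> /andP[/eqP <- /IH h]; rewrite rev_cons -cats1; apply/chain_cat.
by exists (up e) => //=; rewrite !eqxx.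
Qed.

End ChainTheory.

Section ChainEqTheory.
Variables (T L : eqType).
Implicit Types (lo up : T -> L) (s : seq T) (c : L).

Lemma eq_in_chain lo up lo' up' c s c' :
  {in s, lo =1 lo'} -> {in s, up =1 up'} ->
  chain lo up c s c' = chain lo' up' c s c'.
Proof.
elim: s c => [|e s IH] c //= lo_lo' up_up'.
rewrite lo_lo' ?mem_head // up_up' ?mem_head // IH // => z zs;
  by [apply: lo_lo'; rewrite inE zs orbT | apply: up_up'; rewrite inE zs orbT].
Qed.

Lemma chain_last lo up z c s c' :
  s != [::] -> chain lo up c s c' -> up (last z s) = c'.
Proof.
case/lastP: s => // s e _; rewrite last_rcons -cats1 => /chain_cat[m _ /=].
by case/andP=> _ /eqP.
Qed.

Lemma chain_prescribe lo up s b g : uniq s -> size g = size s ->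
  exists lo' up', [/\ {in [predC s], lo =1 lo'}, {in [predC s], up =1 up'},
    chain lo' up' b s (last b g) & map up' s = g].
Proof.
elim: s b g => [|e s IH] b [|a g] //=; first by exists lo, up; split.
move=> /andP[es us] [] /(IH a g us)[lo' [up' [lo_lo' up_up' lo'up' up'g]]].
have neq z : z \in s -> z == e = false by move=> zs; apply: contraNF es => /eqP <-.
exists [eta lo' with e |-> b], [eta up' with e |-> a]; split=> [z|z||] /=.
- by rewrite !inE negb_or => /andP[/negPf-> zs]; apply: lo_lo'.
- by rewrite !inE negb_or => /andP[/negPf-> zs]; apply: up_up'.
- by rewrite !eqxx -(eq_in_chain (lo := lo') (up := up')) // => z /= /neq ->.
- by rewrite eqxx -up'g; congr cons; apply/eq_in_map => z /= /neq ->.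
Qed.

Lemma chain_next lo up c s a : uniq s -> chain lo up c s c -> a \in s ->
  lo (next s a) = up a.
Proof.
move=> us + sa; move: us; case/splitPr: sa => s1 s2 us; rewrite next_cat //.
case/chain_cat=> m s1C /= /andP[/eqP a_m]; case: s2 {us} => [|b s2] /=.
  by move=> /eqP ->; case: s1 s1C => [|d s1] /= => [/eqP ->|/andP[/eqP]].
by case/andP=> /eqP.
Qed.

End ChainEqTheory.

(** * Labelling the gaps of a sweep *)

Section Sweep.
Variables (T : eqType) (n : nat).
(* At step k the line, crossing low k ++ ending k ++ high k, passes vertex k,
   where the edges of ending k are replaced by those of starting k. *)
Variables low ending starting high state : nat -> seq T.
Variable birth : T -> nat.
Hypothesis state_before : forall k, k <= n -> state k = low k ++ ending k ++ high k.
Hypothesis state_after : forall k, k < n -> state k.+1 = low k ++ starting k ++ high k.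
Hypothesis state_init : state 0 = [::].
Hypothesis state_final : low n ++ starting n ++ high n = [::].
Hypothesis starting_uniq : forall k, uniq (starting k).
Hypothesis birth_starting : forall k e, k <= n -> e \in starting k -> birth e = k.
Hypothesis birth_state : forall k e, k <= n -> e \in state k -> birth e < k.

(* Labels of the two sides of each edge and of the gaps above and below each vertex. *)
Record labelling := Labelling {
  lower : T -> nat; upper : T -> nat; below : nat -> nat; above : nat -> nat }.

Implicit Types (lab : labelling) (a b t c k : nat).

Definition lchain lab := chain (lower lab) (upper lab).

Definition vertex_consistent lab k :=
  lchain lab (below lab k) (ending k) (above lab k) &&
  lchain lab (below lab k) (starting k) (above lab k).

Definition consistent lab k := forall j, j < k -> vertex_consistent lab j.

Definition approaches lab k b t :=
  [/\ lchain lab 0 (low k) b, lchain lab b (ending k) t & lchain lab t (high k) 0].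

(* Openings minus merges of label c at the first k vertices: every starting edge
   except the topmost one has an opening gap above it, and if no edge starts at j
   then the gap above j is a merged one. *)
Definition turning lab k c : int :=
  (\sum_(0 <= j < k) ((count_mem c (map (upper lab) (starting j)))%:Z -
                      (above lab j == c)%:Z))%R.

Definition agree lab lab' k :=
  [/\ forall e, birth e < k -> lower lab e = lower lab' e,
      forall e, birth e < k -> upper lab e = upper lab' e,
      forall j, j < k -> below lab j = below lab' j
    & forall j, j < k -> above lab j = above lab' j].

Lemma agree_lchain lab lab' k s b t : agree lab lab' k ->
  {in s, forall e, birth e < k} -> lchain lab b s t = lchain lab' b s t.
Proof.
by move=> [lo up _ _] old; apply: eq_in_chain => e /old; [apply: lo | apply: up].
Qed.

Lemma agree_vertex_consistent lab lab' k j : agree lab lab' k -> j < k -> j <= n ->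
  vertex_consistent lab j = vertex_consistent lab' j.
Proof.
move=> agr jk jn; have [_ _ b t] := agr; rewrite /vertex_consistent b // t //.
rewrite !(agree_lchain _ _ agr) // => e; first by move=> /birth_starting->.
by move=> eL; apply: leq_trans (ltnW jk); apply: birth_state => //;
  rewrite state_before // !mem_cat eL orbT.
Qed.

Lemma agree_turning lab lab' k c : agree lab lab' k -> k <= n.+1 ->
  turning lab k c = turning lab' k c.
Proof.
move=> [_ up _ t] kn; apply: eq_big_nat => j /andP[_ jk]; rewrite t //.
by rewrite (_ : map _ _ = map (upper lab') (starting j)) //;
  apply/eq_in_map => e /birth_starting be; apply: up; rewrite be //; lia.
Qed.

Lemma turningS lab k c : turning lab k.+1 c =
  (turning lab k c + ((count_mem c (map (upper lab) (starting k)))%:Z -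
                      (above lab k == c)%:Z))%R.
Proof. by rewrite /turning big_nat_recr. Qed.

Lemma pass_vertex lab k b t g : k <= n -> consistent lab k -> approaches lab k b t ->
  size g = size (starting k) -> last b g = t ->
  exists lab', [/\ consistent lab' k.+1,
    lchain lab' 0 (low k ++ starting k ++ high k) 0 &
    forall c, turning lab' k.+1 c =
      (turning lab k c + ((count_mem c g)%:Z - (t == c)%:Z))%R].
Proof.
move=> kn lab_ok [lowC endC highC] sz_g last_g.
have [lo [up [lo_eq up_eq startC up_g]]] :=
  chain_prescribe (lower lab) (upper lab) b (starting_uniq k) sz_g.
pose lab' := Labelling lo up [eta below lab with k |-> b] [eta above lab with k |-> t].
have not_starting e : birth e < k -> e \in [predC starting k].
  by apply: contraTN => /(birth_starting kn) ->; rewrite ltnn.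
have agr : agree lab lab' k.
  split=> [e /not_starting /lo_eq //|e /not_starting /up_eq //|j|j] jk /=;
    by rewrite ltn_eqF.
have old s : {subset s <= state k} -> {in s, forall e, birth e < k}.
  by move=> sub e /sub; apply: birth_state.
rewrite last_g in startC; exists lab'; split=> [j||c].
- rewrite ltnS leq_eqVlt => /predU1P[->|jk]; last first.
    by rewrite -(agree_vertex_consistent agr) ?lab_ok //; lia.
  have -> : vertex_consistent lab' k =
    lchain lab' b (ending k) t && lchain lab' b (starting k) t.
    by rewrite /vertex_consistent /= eqxx.
  rewrite [lchain lab' _ (starting k) _]startC andbT.
  by rewrite -(agree_lchain _ _ agr) //; apply: old => e eL;
    rewrite state_before // !mem_cat eL orbT.
- apply/chain_cat; exists b; last (apply/chain_cat; exists t => //).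
    by rewrite -[chain _ _ _ _ _](agree_lchain _ _ agr) //; apply: old => e eL;
      rewrite state_before // mem_cat eL.
  by rewrite -[chain _ _ _ _ _](agree_lchain _ _ agr) //; apply: old => e eL;
    rewrite state_before // !mem_cat eL !orbT.
- by rewrite turningS -(agree_turning c agr) ?leqW //= eqxx up_g.
Qed.

Definition relabel (rho : nat -> nat) lab :=
  Labelling (rho \o lower lab) (rho \o upper lab) (rho \o below lab) (rho \o above lab).

Lemma relabel_lchain rho lab b s t :
  lchain lab b s t -> lchain (relabel rho lab) (rho b) s (rho t).
Proof. exact: chain_relabel. Qed.

Lemma relabel_consistent rho lab k : consistent lab k -> consistent (relabel rho lab) k.
Proof. by move=> ok j /ok/andP[endC startC]; apply/andP; split; apply: relabel_lchain. Qed.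

Definition merge_label (a b z : nat) := if z == a then b else z.

Lemma count_merge_label a b c s : a != b -> count_mem c (map (merge_label a b) s) =
  if c == a then 0 else count_mem c s + (if c == b then count_mem a s else 0).
Proof.
move=> /eqP ab; elim: s => [|z s /= ->]; first by do 2?case: ifP.
have -> : (merge_label a b z == c : nat) =
    if c == a then 0 else (z == c) + (if c == b then (z == a : nat) else 0).
  by rewrite /merge_label; case: (z =P a) => ?; case: (c =P a) => ?; case: (c =P b) => ?; lia.
by case: (c == a); case: (c == b); rewrite ?addn0 // addnACA.
Qed.

Lemma turning_merge_label lab k a b c : a != b ->
  turning (relabel (merge_label a b) lab) k c =
  (if c == a then 0 else turning lab k c + (if c == b then turning lab k a else 0))%R.
Proof.
move=> ab; have mergeE z := count_merge_label c [:: z] ab; rewrite /= in mergeE.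
rewrite /turning; case: ifP => ca.
  apply: big1 => j _; rewrite /= map_comp count_merge_label // ca.
  by have := mergeE (above lab j); rewrite ca; lia.
case: ifP => cb; [rewrite -big_split /=|rewrite addr0]; apply: eq_bigr => j _;
  rewrite map_comp count_merge_label // ca cb;
  by have := mergeE (above lab j); rewrite ca cb /=; lia.
Qed.

(* Labels 1, ..., N - 1 are in use, and label 0 stands for the outside. *)
Definition turning_bounded lab k N :=
  0 < N /\ forall c, (turning lab k c <= (0 < c < N)%:Z)%R.

Definition swept lab k N s :=
  [/\ consistent lab k, turning_bounded lab k N & lchain lab 0 s 0].

Lemma open_gaps lab k b t N : k <= n -> starting k != [::] ->
  consistent lab k -> turning_bounded lab k N -> approaches lab k b t ->
  exists lab' N', swept lab' k.+1 N' (low k ++ starting k ++ high k).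
Proof.
move=> kn startN0 lab_ok [N0 turnN] appr.
pose fresh := iota N (size (starting k)).-1.
have sz_g : size (rcons fresh t) = size (starting k).
  by rewrite size_rcons size_iota prednK // lt0n size_eq0.
have [lab' [ok' C' turn']] := pass_vertex kn lab_ok appr sz_g (last_rcons b fresh t).
exists lab', (N + (size (starting k)).-1); split=> //.
split=> [|c]; first by rewrite addn_gt0 N0.
rewrite turn' -cats1 count_cat (count_uniq_mem _ (iota_uniq _ _)) mem_iota /=.
by have := turnN c; lia.
Qed.

Lemma merge_gaps lab k b t N :
  consistent lab k -> turning_bounded lab k N -> approaches lab k b t ->
  exists lab' u, [/\ consistent lab' k, approaches lab' k u u
    & forall c, (turning lab' k c - (u == c)%:Z <= (0 < c < N)%:Z)%R].
Proof.
move=> lab_ok [_ turnN] appr; have [bt|bt] := eqVneq b t.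
  rewrite -bt in appr; exists lab, b; split=> // c.
  by have := turnN c; lia.
have [lowC endC highC] := appr.
(* The label 0 of the outside must survive the merge. *)
have [a [u [au a0 b_u t_u]]] :
    exists a u, [/\ a != u, a != 0, merge_label a u b = u & merge_label a u t = u].
  rewrite /merge_label; have [t0|t0] := eqVneq t 0.
    by rewrite t0 in bt *; exists b, 0; rewrite eqxx if_same.
  by exists t, b; rewrite eq_sym eqxx (negPf bt).
exists (relabel (merge_label a u) lab), u.
have zero_fixed : merge_label a u 0 = 0 by rewrite /merge_label eq_sym (negPf a0).
have merged := relabel_lchain (merge_label a u); split.
- exact: relabel_consistent.
- split; first by have := merged _ _ _ _ lowC; rewrite zero_fixed b_u.
    by have := merged _ _ _ _ endC; rewrite b_u t_u.
  by have := merged _ _ _ _ highC; rewrite zero_fixed t_u.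
move=> c; rewrite turning_merge_label // [u == c]eq_sym.
have := turnN c; have := turnN a.
by case: (c =P a) => ?; case: (c =P u) => ?; lia.
Qed.

Lemma close_gap lab k b t N : k <= n -> starting k = [::] ->
  consistent lab k -> turning_bounded lab k N -> approaches lab k b t ->
  exists lab' N', swept lab' k.+1 N' (low k ++ starting k ++ high k).
Proof.
move=> kn start0 lab_ok bnd appr; have [N0 _] := bnd.
have [lab' [u [ok' appr' turn']]] := merge_gaps lab_ok bnd appr.
have sz_g : size ([::] : seq nat) = size (starting k) by rewrite start0.
have [lab'' [ok'' C'' turn'']] := pass_vertex kn ok' appr' sz_g erefl.
by exists lab'', N; split=> //; split=> // c; rewrite turn'' sub0r.
Qed.

Lemma sweep_invariant k : k <= n -> exists lab N, swept lab k N (state k).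
Proof.
elim: k => [|k IH] kn.
  exists (Labelling (fun=> 0) (fun=> 0) (fun=> 0) (fun=> 0)), 1.
  by rewrite state_init; split=> //; split=> // c; rewrite /turning big_geq.
have [lab [N [lab_ok bnd]]] := IH (ltnW kn); rewrite state_before ?(ltnW kn) //.
move=> /chain_cat[b lowC /chain_cat[t endC highC]]; rewrite state_after //.
have appr : approaches lab k b t by [].
have [start0|startN0] := eqVneq (starting k) [::].
  exact: close_gap (ltnW kn) start0 lab_ok bnd appr.
exact: open_gaps (ltnW kn) startN0 lab_ok bnd appr.
Qed.

Lemma sweep_labelling : exists lab, consistent lab n.+1 /\
  forall c, (turning lab n.+1 c <= if c == 0 then -1 else 1)%R.
Proof.
have [lab [N [lab_ok [_ turnN] stateC]]] := sweep_invariant (leqnn n).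
have [low0 start0 high0] : [/\ low n = [::], starting n = [::] & high n = [::]].
  by case: (low n) (starting n) (high n) state_final => // -[] // -[].
have appr : approaches lab n 0 0.
  by rewrite state_before // low0 high0 cats0 in stateC; split; rewrite ?low0 ?high0.
have sz_g : size ([::] : seq nat) = size (starting n) by rewrite start0.
have [lab' [ok' _ turn']] := pass_vertex (leqnn n) lab_ok appr sz_g erefl.
by exists lab'; split=> // c; rewrite turn' sub0r; have := turnN c; case: (c =P 0) => ?; lia.
Qed.

End Sweep.

(** * Sweeping a straight-line drawing *)

Lemma affine_sign_change (R : realFieldType) (a b z w : R) :
  (0 < a + b * z -> a + b * w <= 0 ->
   exists2 s, 0 < s <= 1 & a + b * ((1 - s) * z + s * w) = 0)%R.
Proof.
move=> z_gt0 w_le0; have d_gt0 : (0 < b * z - b * w)%R by lra.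
exists ((a + b * z) / (b * z - b * w))%R.
  by rewrite divr_gt0 // ler_pdivrMr // mul1r; lra.
by have dN0 := lt0r_neq0 d_gt0; field.
Qed.

Section Drawing.
Variables (R : realFieldType) (n : nat) (pos : nat -> R * R) (e : rel nat).
Local Open Scope ring_scope.
Implicit Types (i j k : nat) (p q : nat * nat) (z : R).
Local Notation x i := (pos i).1.
Local Notation y i := (pos i).2.

Definition slope i j : R := (y j - y i) / (x j - x i).
Definition height p z : R := y p.1 + slope p.1 p.2 * (z - x p.1).
Definition is_edge p : bool := e p.1 p.2 && (p.1 < p.2)%N.
Definition strictly_over p z : bool := x p.1 < z < x p.2.
Definition weakly_over p z : bool := x p.1 <= z <= x p.2.

(* Vertices are 0, ..., n, numbered by increasing abscissa. *)
Record drawing : Prop := Drawing {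
  adj_sym : symmetric e;
  adj_irr : irreflexive e;
  adj_le : forall i j, e i j -> (i <= n)%N;
  abscissa_incr : forall i j, (i < j <= n)%N -> x i < x j;
  noncrossing : forall p q z, is_edge p -> is_edge q -> p != q ->
    strictly_over p z -> strictly_over q z -> height p z != height q z;
  off_vertices : forall p k, is_edge p -> (p.1 < k < p.2)%N ->
    height p (x k) != y k }.

Hypothesis drawn : drawing.

Lemma is_edge_le p : is_edge p -> (p.1 < p.2 <= n)%N.
Proof. by case/andP => ep ->; rewrite (adj_le drawn (j := p.1)) // adj_sym. Qed.

Lemma adj_le_both i j : e i j -> (i <= n)%N /\ (j <= n)%N.
Proof.
by move=> eij; rewrite (adj_le drawn eij) (adj_le drawn (j := i)) // (adj_sym drawn).
Qed.

Lemma adj_neq i j : e i j -> i != j.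
Proof. by apply: contraTneq => ->; rewrite (adj_irr drawn). Qed.

Lemma lt_abscissa i j : (i <= n)%N -> (j <= n)%N -> (x i < x j) = (i < j)%N.
Proof.
move=> iln jln; case: ltngtP => [ij|ji|->]; rewrite ?ltxx //.
  by rewrite (abscissa_incr drawn) // ij.
by apply/negbTE; rewrite -leNgt ltW // (abscissa_incr drawn) // ji.
Qed.

Lemma le_abscissa i j : (i <= n)%N -> (j <= n)%N -> (x i <= x j) = (i <= j)%N.
Proof. by move=> iln jln; rewrite leNgt lt_abscissa // -leqNgt. Qed.

Lemma abscissa_inj i j : (i <= n)%N -> (j <= n)%N -> x i = x j -> i = j.
Proof.
move=> iln jln xij; have := lt_abscissa iln jln; have := lt_abscissa jln iln.
by rewrite xij ltxx; case: ltngtP.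
Qed.

Lemma sub_abscissa_neq0 i j : e i j -> x j - x i != 0.
Proof.
move=> eij; have [iln jln] := adj_le_both eij; rewrite subr_eq0.
by apply: contraNneq (adj_neq eij) => /abscissa_inj ->.
Qed.

Lemma slopeC i j : slope i j = slope j i.
Proof. by rewrite /slope -[y j - _]opprB -[x j - _]opprB invrN mulrNN. Qed.

Lemma slope_sub_abscissa i j : e i j -> slope i j * (x j - x i) = y j - y i.
Proof. by move=> eij; rewrite mulfVK // sub_abscissa_neq0. Qed.

Lemma height_left p : height p (x p.1) = y p.1.
Proof. by rewrite /height subrr mulr0 addr0. Qed.

Lemma height_from_right p z : is_edge p ->
  height p z = y p.2 + slope p.2 p.1 * (z - x p.2).
Proof.
by case/andP=> ep _; rewrite [slope p.2 _]slopeC /height; have := slope_sub_abscissa ep; lra.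
Qed.

Lemma height_right p : is_edge p -> height p (x p.2) = y p.2.
Proof. by move=> ep; rewrite height_from_right // subrr mulr0 addr0. Qed.

Lemma height_lt_transfer p q z w : is_edge p -> is_edge q ->
  weakly_over p z -> weakly_over q z -> strictly_over p w -> strictly_over q w ->
  height p z < height q z -> height p w < height q w.
Proof.
move=> ep eq pz qz pw qw lt_z; rewrite ltNge; apply/negP => le_w.
have qp : q != p by apply: contraTneq lt_z => ->; rewrite ltxx.
pose b := slope q.1 q.2 - slope p.1 p.2; pose a := height q 0 - height p 0.
have diffE u : a + b * u = height q u - height p u by rewrite /a /b /height; ring.
have [s s01 crossing] : exists2 s, 0 < s <= 1 & a + b * ((1 - s) * z + s * w) = 0.
  by apply: affine_sign_change; rewrite diffE ?subr_gt0 ?subr_le0.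
have over r : weakly_over r z -> strictly_over r w -> strictly_over r ((1 - s) * z + s * w).
  by move=> /andP[? ?] /andP[? ?]; case/andP: s01 => ? ?; apply/andP; split; nra.
have /eqP[] := noncrossing drawn eq ep qp (over q qz qw) (over p pz pw).
by apply/eqP; rewrite -subr_eq0 -diffE crossing.
Qed.

Lemma slope_inj i j k : e i j -> e i k -> (i < j)%N = (i < k)%N ->
  slope i j = slope i k -> j = k.
Proof.
wlog jk : j k / (j <= k)%N.
  by move=> IH eij eik side s; have [/IH->|/ltnW/IH->] := leqP j k.
move=> eij eik side s; apply/eqP; move: jk; rewrite leq_eqVlt => /predU1P[-> //|jk].
have [ij|ji] := ltnP i j.
  have edge_ik : is_edge (i, k) by rewrite /is_edge /= eik (ltn_trans ij).
  have /eqP[] := off_vertices drawn edge_ik (k := j) (introT andP (conj ij jk)).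
  by rewrite /height /= -s slope_sub_abscissa // addrC subrK.
have ki : (k < i)%N by rewrite ltn_neqAle eq_sym adj_neq // leqNgt -side -leqNgt.
have edge_ji : is_edge (j, i) by rewrite /is_edge /= adj_sym // eij (ltn_trans jk).
have /eqP[] := off_vertices drawn edge_ji (k := k) (introT andP (conj jk ki)).
by rewrite height_from_right //= s slope_sub_abscissa // addrC subrK.
Qed.

Definition nbrs_where i (A : pred nat) :=
  sort_by (slope i) [seq j <- iota 0 n.+1 | e i j && A j].
Definition left_nbrs i := nbrs_where i (fun j => j < i)%N.
Definition right_nbrs i := nbrs_where i (fun j => i < j)%N.

Lemma mem_nbrs_where i A j : (j \in nbrs_where i A) = e i j && A j.
Proof.
rewrite mem_sort mem_filter mem_iota ltnS /= andb_idr // => /andP[eij _].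
by have [] := adj_le_both eij.
Qed.

Lemma nbrs_where_uniq i A : uniq (nbrs_where i A).
Proof. by rewrite sort_uniq filter_uniq ?iota_uniq. Qed.

Lemma nbrs_where_sorted i A : {in A &, forall j k, (i < j)%N = (i < k)%N} ->
  sorted (key_lt (slope i)) (nbrs_where i A).
Proof.
move=> side; apply: sort_by_sorted; last by rewrite filter_uniq ?iota_uniq.
move=> j k; rewrite !mem_filter => /andP[/andP[eij Aj] _] /andP[/andP[eik Ak] _].
by apply: slope_inj => //; apply: side.
Qed.

Lemma left_nbrs_sorted i : sorted (key_lt (slope i)) (left_nbrs i).
Proof.
by apply: nbrs_where_sorted => j k ji ki; rewrite !ltnNge (ltnW ji) (ltnW ki).
Qed.

Lemma right_nbrs_sorted i : sorted (key_lt (slope i)) (right_nbrs i).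
Proof. by apply: nbrs_where_sorted => j k; rewrite !unfold_in => -> ->. Qed.

Definition edges :=
  [seq p <- [seq (i, j) | i <- iota 0 n.+1, j <- iota 0 n.+1] | is_edge p].

Lemma mem_edges p : (p \in edges) = is_edge p.
Proof.
rewrite mem_filter andb_idr // => /is_edge_le p12; apply/allpairsPdep.
by exists p.1, p.2; rewrite !mem_iota -surjective_pairing; split=> //; lia.
Qed.

Lemma edges_uniq : uniq edges.
Proof. by rewrite filter_uniq // allpairs_uniq ?iota_uniq // => -[? ?] [? ?]. Qed.

Definition line_edges z := sort_by (height^~ z) [seq p <- edges | strictly_over p z].

Lemma mem_line_edges z p : (p \in line_edges z) = is_edge p && strictly_over p z.
Proof. by rewrite mem_sort mem_filter mem_edges andbC. Qed.

Lemma line_edges_sorted z : sorted (key_lt (height^~ z)) (line_edges z).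
Proof.
apply: sort_by_sorted; last exact: filter_uniq edges_uniq.
move=> p q; rewrite !(mem_filter (strictly_over^~ z)) !mem_edges.
by move=> /andP[pz ep] /andP[qz eq] /eqP; apply: contraTeq => pq; apply: noncrossing.
Qed.

Lemma strictly_over_vertex p k : is_edge p -> (k <= n)%N ->
  strictly_over p (x k) = (p.1 < k < p.2)%N.
Proof. by move=> /is_edge_le ? ?; rewrite /strictly_over !lt_abscissa //; lia. Qed.

Lemma weakly_over_vertex p k : is_edge p -> (p.1 <= k <= p.2)%N -> weakly_over p (x k).
Proof. by move=> /is_edge_le ? ?; rewrite /weakly_over !le_abscissa //; lia. Qed.

Lemma strictly_over_gap p k z : is_edge p -> (k < n)%N -> x k < z < x k.+1 ->
  strictly_over p z = (p.1 <= k < p.2)%N.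
Proof.
move=> /is_edge_le p12 kn /andP[kz zk]; congr andb; apply/idP/idP => [h|h].
- by rewrite -ltnS -lt_abscissa; [apply: lt_trans zk| |]; lia.
- by apply: le_lt_trans kz; rewrite le_abscissa; lia.
- by rewrite -lt_abscissa; [apply: lt_trans kz _| |]; lia.
- by apply: lt_le_trans zk _; rewrite le_abscissa; lia.
Qed.

Definition low_edges k := [seq p <- line_edges (x k) | height p (x k) < y k].
Definition high_edges k := [seq p <- line_edges (x k) | y k < height p (x k)].
Definition ending_edges k := [seq (j, k) | j <- rev (left_nbrs k)].
Definition starting_edges k := [seq (k, j) | j <- right_nbrs k].
Definition sweep_edges k := line_edges ((x k.-1 + x k) / 2).

Lemma mem_through_edges k p : (k <= n)%N ->
  (p \in low_edges k) || (p \in high_edges k) = is_edge p && (p.1 < k < p.2)%N.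
Proof.
move=> kn; rewrite !mem_filter mem_line_edges -andb_orl.
case ep: (is_edge p); rewrite ?andbF //= strictly_over_vertex //.
by rewrite andbC andb_idr // => through; rewrite -neq_lt (off_vertices drawn).
Qed.

Lemma mem_ending_edges k p : (p \in ending_edges k) = is_edge p && (p.2 == k).
Proof.
apply/mapP/andP => [[j]|[/andP[ep lp] /eqP pk]].
  by rewrite mem_rev mem_nbrs_where => /andP[ej jk ->]; rewrite /is_edge /= adj_sym ?ej.
exists p.1; last by rewrite -pk -surjective_pairing.
by rewrite mem_rev mem_nbrs_where -pk adj_sym ?ep.
Qed.

Lemma mem_starting_edges k p : (p \in starting_edges k) = is_edge p && (p.1 == k).
Proof.
apply/mapP/andP => [[j]|[/andP[ep lp] /eqP pk]].
  by rewrite mem_nbrs_where => /andP[ej jk ->]; rewrite /is_edge /= ej.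
by exists p.2; [rewrite mem_nbrs_where -pk ep | rewrite -pk -surjective_pairing].
Qed.

Lemma mem_sweep_edges k p : (k <= n)%N ->
  (p \in sweep_edges k) = is_edge p && (p.1 < k <= p.2)%N.
Proof.
rewrite mem_line_edges; case: k => [|k] kn /=; case ep: (is_edge p) => //=.
  have -> : (x 0%N + x 0%N) / 2 = x 0%N by field.
  by rewrite strictly_over_vertex.
apply: strictly_over_gap => //; have : x k < x k.+1 by rewrite lt_abscissa // ltnW.
by move=> ?; apply/andP; split; lra.
Qed.

Lemma incident_height k p : is_edge p -> (p.1 == k) || (p.2 == k) ->
  height p (x k) = y k.
Proof. by move=> ep /orP[] /eqP <-; [exact: height_left|exact: height_right]. Qed.

Lemma line_edges_transfer w z p q : p \in line_edges z -> q \in line_edges z ->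
  weakly_over p w -> weakly_over q w ->
  key_lt (height^~ w) p q -> key_lt (height^~ z) p q.
Proof.
rewrite !mem_line_edges => /andP[ep pz] /andP[eq qz] pw qw.
exact: height_lt_transfer.
Qed.

Lemma through_edges_pairwise k z (A : pred (nat * nat)) :
  {subset [seq p <- line_edges (x k) | A p] <= line_edges z} ->
  pairwise (key_lt (height^~ z)) [seq p <- line_edges (x k) | A p].
Proof.
move=> sub; rewrite -sorted_pairwise; last exact: key_lt_trans.
move: (line_edges_sorted (x k)) => /(sorted_filter (@key_lt_trans _ _ _ (height^~ (x k))) A).
apply: (sub_in_sorted (P := [in [seq p <- line_edges (x k) | A p]])); last exact/allP.
have weak p : p \in [seq p <- line_edges (x k) | A p] -> weakly_over p (x k).
  rewrite mem_filter mem_line_edges => /and3P[_ _ /andP[? ?]].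
  by rewrite /weakly_over !ltW.
by move=> p q pA qA; apply: line_edges_transfer; rewrite ?sub ?weak.
Qed.

Lemma line_edges_split k z s : (k <= n)%N ->
  line_edges z =i low_edges k ++ s ++ high_edges k ->
  {in s, forall p, (p.1 == k) || (p.2 == k)} -> sorted (key_lt (height^~ z)) s ->
  line_edges z = low_edges k ++ s ++ high_edges k.
Proof.
move=> kn split_z incident s_sorted; have tr := @key_lt_trans _ _ _ (height^~ z).
have through_weakly_over p : (p \in low_edges k) || (p \in high_edges k) ->
    weakly_over p (x k).
  by rewrite mem_through_edges // => /andP[ep ?]; apply: weakly_over_vertex => //; lia.
have line_low p : p \in low_edges k ->
    [/\ p \in line_edges z, weakly_over p (x k) & height p (x k) < y k].
  move=> pl; split; first by rewrite split_z mem_cat pl.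
    by apply: through_weakly_over; rewrite pl.
  by move: pl; rewrite mem_filter => /andP[].
have line_high p : p \in high_edges k ->
    [/\ p \in line_edges z, weakly_over p (x k) & y k < height p (x k)].
  move=> ph; split; first by rewrite split_z !mem_cat ph !orbT.
    by apply: through_weakly_over; rewrite ph orbT.
  by move: ph; rewrite mem_filter => /andP[].
have line_s p : p \in s ->
    [/\ p \in line_edges z, weakly_over p (x k) & height p (x k) = y k].
  move=> ps; have pz : p \in line_edges z by rewrite split_z !mem_cat ps orbT.
  have /andP[ep _] : is_edge p && strictly_over p z by rewrite -mem_line_edges.
  have pk := incident _ ps; split=> //; last exact: incident_height.
  by apply: weakly_over_vertex => //; have := is_edge_le ep; case/orP: pk => /eqP; lia.
have s_pairwise : pairwise (key_lt (height^~ z)) s by rewrite -sorted_pairwise.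
apply: sort_by_eq; first exact: filter_uniq edges_uniq.
  by move=> p; rewrite -split_z mem_sort.
rewrite sorted_pairwise // !pairwise_cat s_pairwise !through_edges_pairwise //;
  try by [move=> p /line_low[] | move=> p /line_high[]].
rewrite !andbT; apply/andP; split; apply/allrelP => p q.
  move=> /line_low[pz pw p_lt]; rewrite mem_cat => /orP[/line_s|/line_high] [qz qw q_gt];
    apply: line_edges_transfer pz qz pw qw _; first by rewrite /key_lt /= q_gt.
  exact: lt_trans q_gt.
move=> /line_s[pz pw p_eq] /line_high[qz qw q_gt].
by apply: line_edges_transfer pz qz pw qw _; rewrite /key_lt /= p_eq.
Qed.

Lemma ending_edges_sorted k z : z < x k -> sorted (key_lt (height^~ z)) (ending_edges k).
Proof.
move=> zk; have sorted_rev : sorted (fun i j => key_lt (slope k) j i) (rev (left_nbrs k)).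
  by rewrite rev_sorted left_nbrs_sorted.
apply: (homo_sorted_in (P := [in rev (left_nbrs k)]) _ _ sorted_rev); last exact/allP.
move=> i j; rewrite !mem_rev !mem_nbrs_where => /andP[ei ik] /andP[ej jk].
rewrite /key_lt /= !height_from_right; try by rewrite /is_edge /= adj_sym ?ei ?ej.
by rewrite ltrD2l ltr_nM2r // subr_lt0.
Qed.

Lemma starting_edges_sorted k z : x k < z -> sorted (key_lt (height^~ z)) (starting_edges k).
Proof.
move=> kz; rewrite sorted_map; apply: sub_sorted (right_nbrs_sorted k) => i j.
by rewrite /key_lt /height /= ltrD2l ltr_pM2r // subr_gt0.
Qed.

Lemma sweep_edges_before k : (k <= n)%N ->
  sweep_edges k = low_edges k ++ ending_edges k ++ high_edges k.
Proof.
move=> kn; apply: line_edges_split => // [p|p|].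
- rewrite -/(sweep_edges k) mem_sweep_edges // !mem_cat orbCA mem_through_edges //.
  rewrite mem_ending_edges -andb_orr; case ep: (is_edge p) => //=.
  by have := is_edge_le ep; lia.
- by rewrite mem_ending_edges => /andP[_ ->]; rewrite orbT.
case: k kn => [|k] kn.
  rewrite (notin_nil (s := ending_edges 0%N)) // => p.
  by rewrite mem_ending_edges; apply/negP => /andP[/is_edge_le + /eqP p0]; rewrite p0.
apply: ending_edges_sorted => /=.
have : x k < x k.+1 by rewrite lt_abscissa // ltnW.
by lra.
Qed.

Lemma sweep_edges_after k : (k < n)%N ->
  sweep_edges k.+1 = low_edges k ++ starting_edges k ++ high_edges k.
Proof.
move=> kn; apply: line_edges_split => [|p|p|]; first exact: ltnW.
- rewrite -/(sweep_edges k.+1) mem_sweep_edges // !mem_cat orbCA.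
  rewrite (mem_through_edges _ (ltnW kn)) mem_starting_edges -andb_orr.
  by case ep: (is_edge p) => //=; have := is_edge_le ep; lia.
- by rewrite mem_starting_edges => /andP[_ ->].
apply: starting_edges_sorted => /=.
have : x k < x k.+1 by rewrite lt_abscissa // ltnW.
by lra.
Qed.

Lemma drawing_labelling : exists lab : labelling (nat * nat)%type,
  consistent ending_edges starting_edges lab n.+1 /\
  forall c, turning starting_edges lab n.+1 c <= if c == 0%N then -1 else 1.
Proof.
apply: (sweep_labelling (birth := fst) sweep_edges_before sweep_edges_after).
- by apply: notin_nil => p; rewrite mem_sweep_edges // andbF.
- apply: notin_nil => p; rewrite !mem_cat orbCA mem_through_edges // mem_starting_edges.
  by rewrite -andb_orr; apply/negP => /andP[/is_edge_le]; lia.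
- by move=> k; rewrite map_inj_uniq ?nbrs_where_uniq // => i j [].
- by move=> k p _; rewrite mem_starting_edges => /andP[_ /eqP].
- by move=> k p kn; rewrite mem_sweep_edges // => /and3P[].
Qed.

End Drawing.

(** * Euclidean plane *)

Section PlaneGeometry.
Variable R : realType.
Local Open Scope ring_scope.
Implicit Types (a b : R) (o p q r s : plane R).

Lemma add1_sqr_gt0 a : 0 < 1 + a ^+ 2.
Proof. by rewrite ltr_pwDl ?sqr_ge0. Qed.

Lemma cos_pi3 : cos (pi / 3 : R) = 2^-1.
Proof.
have pi_pos := @pi_gt0 R.
have cos_pos : 0 < cos (pi / 3 : R) by apply: cos_gt0_pihalf; apply/andP; split; lra.
have triple_angle : cos (pi / 3 *+ 2 + pi / 3 : R) = - 1.
  by rewrite -cospi; congr cos; field.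
move: triple_angle cos_pos; rewrite cosD cos_mulr2n sin_mulr2n.
have := sin2cos2 (pi / 3 : R); move: (cos _) (sin _) => c s s2 triple c_pos.
have : (c + 1) * (2 * c - 1) ^+ 2 = 0.
  transitivity (4 * c ^+ 3 - 3 * c + 1); first by ring.
  have -> : 4 * c ^+ 3 - 3 * c = (c ^+ 2 *+ 2 - 1) * c - c * (1 - c ^+ 2) *+ 2 by ring.
  by move: triple; rewrite -mulrnAl -mulrA -expr2 s2; lra.
by move=> /eqP; rewrite mulf_eq0 sqrf_eq0 => /orP[] /eqP; lra.
Qed.

Lemma cos_gt_half a : 0 < a < pi / 3 -> 2^-1 < cos a.
Proof.
move=> /andP[a_gt0 a_lt]; rewrite -cos_pi3 ltr_cos // in_itv /=; have := @pi_gt0 R; lra.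
Qed.

Lemma cos_eq1 a : 0 <= a < pi *+ 2 -> cos a = 1 -> a = 0.
Proof.
rewrite -cos0 => /andP[a_ge0 a_lt] cosa.
have [a_le|a_gt] := leP a pi.
  by apply: cos_inj; rewrite // in_itv /= ?lexx ?a_ge0 ?pi_ge0.
have : pi *+ 2 - a = 0; last by lra.
apply: cos_inj; rewrite ?in_itv /= ?lexx ?pi_ge0 //.
  by rewrite mulr2n in a_lt *; apply/andP; split; lra.
by rewrite addrC cosD2pi cosN.
Qed.

Lemma cos_sin_inj a b : 0 <= a < pi *+ 2 -> 0 <= b < pi *+ 2 ->
  cos a = cos b -> sin a = sin b -> a = b.
Proof.
wlog ab : a b / a <= b.
  by move=> IH ha hb c s; have [/IH->|/ltW/IH->] := leP a b.
move=> /andP[a_ge0 a_lt] /andP[b_ge0 b_lt] cos_ab sin_ab.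
suff : b - a = 0 by lra.
apply: cos_eq1; first by apply/andP; split; lra.
by rewrite cosB cos_ab sin_ab -!expr2 cos2Dsin2.
Qed.

Lemma sqr_edist p q : edist p q ^+ 2 = (p.1 - q.1) ^+ 2 + (p.2 - q.2) ^+ 2.
Proof. by rewrite sqr_sqrtr // addr_ge0 ?sqr_ge0. Qed.

Definition dot (u v : R * R) : R := u.1 * v.1 + u.2 * v.2.
Definition cross (u v : R * R) : R := u.1 * v.2 - u.2 * v.1.

Lemma dot_polarization o p q :
  2 * dot (p - o) (q - o) = edist o p ^+ 2 + edist o q ^+ 2 - edist p q ^+ 2.
Proof. by rewrite !sqr_edist /dot /=; ring. Qed.

Lemma dot_eq0 (u : R * R) : (dot u u == 0) = (u == 0).
Proof.
by rewrite paddr_eq0 -?expr2 ?sqr_ge0 // !sqrf_eq0 -xpair_eqE -surjective_pairing.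
Qed.

Lemma edist_gt0 p q : p <> q -> 0 < edist p q.
Proof.
move=> /eqP pq; rewrite lt_neqAle sqrtr_ge0 andbT eq_sym -sqrf_eq0 sqr_edist !expr2.
by rewrite -[_ + _]/(dot (p - q) (p - q)) dot_eq0 subr_eq0.
Qed.

(* In the plane, u and v form an orthogonal basis. *)
Lemma orthogonal_eq0 (u v w : R * R) : u != 0 -> v != 0 ->
  dot u v = 0 -> dot w u = 0 -> dot w v = 0 -> w = 0.
Proof.
move=> u0 v0 uv wu wv; apply/eqP; rewrite -dot_eq0.
have : dot w w * (dot u u * dot v v) == 0.
  apply/eqP; transitivity (dot w w * (dot u v ^+ 2 + cross u v ^+ 2)).
    by rewrite /dot /cross; ring.
  transitivity (dot w w * dot u v ^+ 2 + (dot w u * v.2 - dot w v * u.2) ^+ 2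
    + (dot w v * u.1 - dot w u * v.1) ^+ 2); first by rewrite /dot /cross; ring.
  by rewrite uv wu wv; ring.
by rewrite !mulf_eq0 !dot_eq0 (negPf u0) (negPf v0) !orbF.
Qed.

Lemma rhombus_parallelogram p q r s (l : R) : p <> r -> q <> s ->
  edist p q = l -> edist p s = l -> edist r q = l -> edist r s = l -> p + r = q + s.
Proof.
move=> pr qs pq ps rq rs; apply/eqP; rewrite -subr_eq0; apply/eqP.
have := sqr_edist r s; have := sqr_edist r q; have := sqr_edist p s; have := sqr_edist p q.
rewrite pq ps rq rs => pq2 ps2 rq2 rs2.
by apply: (@orthogonal_eq0 (q - s) (p - r)); rewrite ?subr_eq0; try exact/eqP;
  rewrite /dot /=; lra.
Qed.

Lemma dot_parallelogram p q r s : p + r = q + s ->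
  dot (s - r) (q - r) = dot (q - p) (s - p).
Proof. by case=> sum1 sum2; rewrite /dot /=; nra. Qed.

Lemma cross_parallelogram p q r s : p + r = q + s ->
  cross (s - r) (q - r) = cross (q - p) (s - p).
Proof. by case=> sum1 sum2; rewrite /cross /=; nra. Qed.

End PlaneGeometry.

(** * Corners and faces *)

Section Corners.
Variables (R : realType) (n : nat) (pos : nat -> plane R) (e : rel nat).
Local Open Scope ring_scope.
Hypothesis drawn : drawing n pos e.
Implicit Types (i j k : nat) (d : nat * nat).
Local Notation x i := (pos i).1.
Local Notation y i := (pos i).2.

(* The neighbours of i in counterclockwise order, starting from the vertical
   upward direction. *)
Definition nbrs i := left_nbrs n pos e i ++ right_nbrs n pos e i.

Lemma mem_nbrs i j : (j \in nbrs i) = e i j.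
Proof.
rewrite mem_cat !(mem_nbrs_where drawn) -andb_orr -neq_ltn andb_idr //.
by rewrite eq_sym => /(adj_neq drawn).
Qed.

Lemma nbrs_uniq i : uniq (nbrs i).
Proof.
rewrite cat_uniq !nbrs_where_uniq andbT /=.
by apply/hasPn => j; rewrite !(mem_nbrs_where drawn) => /andP[_ ij];
  rewrite negb_and ltnNge (ltnW ij) orbT.
Qed.

Lemma size_nbrs i : size (nbrs i) = count (e i) (iota 0 n.+1).
Proof.
rewrite -size_filter; apply/perm_size/uniq_perm; rewrite ?nbrs_uniq ?filter_uniq ?iota_uniq //.
by move=> j; rewrite mem_nbrs mem_filter mem_iota andb_idr // => /(adj_le_both drawn)[].
Qed.

(* Angles are measured from the negative x-axis. *)
Definition direction i j : R := atan (slope pos i j) + (if (i < j)%N then pi else 0).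

Lemma direction_bounds i j : - (pi / 2) < direction i j < pi / 2 + pi.
Proof.
have := atan_ltpi2 (slope pos i j); have := atan_gtNpi2 (slope pos i j); have := @pi_gt0 R.
by rewrite /direction; case: ifP => _ *; apply/andP; split; lra.
Qed.

Lemma direction_rev i j : i != j ->
  direction i j = direction j i + pi * (1 - 2 * (j < i)%N%:R).
Proof. by rewrite /direction [slope pos j i]slopeC; case: ltngtP => //= _ _; ring. Qed.

Lemma nbrs_sorted i : sorted (key_lt (direction i)) (nbrs i).
Proof.
have tr f := @key_lt_trans _ R nat f; rewrite sorted_pairwise // pairwise_cat.
have same_side s : {in s &, forall j k, (i < j)%N = (i < k)%N} ->
    sorted (key_lt (slope pos i)) s -> pairwise (key_lt (direction i)) s.
  move=> side sS; rewrite -sorted_pairwise //.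
  apply: (sub_in_sorted (P := [in s])) (sS) => [j k js ks lt_jk|]; last exact/allP.
  by rewrite /key_lt /= /direction (side j k) // ltrD2r lt_atan.
rewrite !same_side ?(left_nbrs_sorted drawn) ?(right_nbrs_sorted drawn) ?andbT //.
- apply/allrelP => j k; rewrite !(mem_nbrs_where drawn) => /andP[_ ji] /andP[_ ik].
  rewrite /key_lt /= /direction ik ltnNge (ltnW ji) /=.
  have := atan_ltpi2 (slope pos i j); have := atan_gtNpi2 (slope pos i k).
  by have := @pi_gt0 R; lra.
- by move=> j k; rewrite !(mem_nbrs_where drawn) => /andP[_ ->] /andP[_ ->].
- move=> j k; rewrite !(mem_nbrs_where drawn) => /andP[_ ji] /andP[_ ki].
  by rewrite !ltnNge (ltnW ji) (ltnW ki).
Qed.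

Lemma edist_cos_slope i j : e i j ->
  edist (pos i) (pos j) * cos (atan (slope pos i j)) = `|x j - x i|.
Proof.
move=> eij; set s := slope pos i j.
have -> : edist (pos i) (pos j) = `|x j - x i| * Num.sqrt (1 + s ^+ 2).
  rewrite -sqrtr_sqr -sqrtrM ?sqr_ge0 //; congr Num.sqrt.
  rewrite mulrDr mulr1 -exprMn [_ * s]mulrC (slope_sub_abscissa drawn eij).
  by rewrite -[x j - x i]opprB -[y j - y i]opprB !sqrrN.
by rewrite cos_atan mulfK // gt_eqF // sqrtr_gt0 add1_sqr_gt0.
Qed.

Lemma edge_vector i j : e i j ->
  x j - x i = - edist (pos i) (pos j) * cos (direction i j) /\
  y j - y i = - edist (pos i) (pos j) * sin (direction i j).
Proof.
move=> eij; have [iln jln] := adj_le_both drawn eij.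
have sin_slope : sin (atan (slope pos i j)) = slope pos i j * cos (atan (slope pos i j)).
  rewrite -{2}[slope pos i j]atanK /tan mulfVK // gt_eqF //.
  by apply: cos_gt0_pihalf; rewrite atan_gtNpi2 atan_ltpi2.
have := edist_cos_slope eij; rewrite -(slope_sub_abscissa drawn eij) /direction.
case: ltngtP (adj_neq drawn eij) => // [ij|ji] _.
  rewrite gtr0_norm ?subr_gt0 ?(lt_abscissa drawn) // cosDpi sinDpi sin_slope => dist_cos.
  by rewrite !mulrNN -{}dist_cos; split; ring.
rewrite ltr0_norm ?subr_lt0 ?(lt_abscissa drawn) // addr0 sin_slope => dist_cos.
have -> : x j - x i = - (edist (pos i) (pos j) * cos (atan (slope pos i j))).
  by rewrite dist_cos opprK.
by split; ring.
Qed.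

(* The dart (i, j) is the edge ij traversed from i to j; it stands for the corner
   at i between ij and the next edge. *)
Definition dart d := e d.1 d.2.
Definition ccw i j := next (nbrs i) j.
(* One step backwards along the face to the left of the dart. *)
Definition face_pred d := (ccw d.1 d.2, d.1).
(* The corner contains the upward vertical direction, where directions jump. *)
Definition wraps d := d.2 == last 0%N (nbrs d.1).
Definition rightward d := (d.1 < d.2)%N.
Definition corner_angle d : R :=
  direction d.1 (ccw d.1 d.2) - direction d.1 d.2 + (wraps d)%:R * (pi *+ 2).

Lemma ccw_adj i j : e i (ccw i j) = e i j.
Proof. by rewrite -!mem_nbrs mem_next. Qed.

Lemma ccw_inj i : injective (ccw i).
Proof. by apply: (can_inj (g := prev (nbrs i))) => j; rewrite prev_next ?nbrs_uniq. Qed.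

Lemma dart_face_pred d : dart (face_pred d) = dart d.
Proof. by rewrite /dart /= (adj_sym drawn) ccw_adj. Qed.

Lemma face_pred_inj : injective face_pred.
Proof. by move=> [i j] [i' j'] [+ ii']; rewrite /= -ii' => /ccw_inj ->. Qed.

Lemma direction_ccw i j : e i j -> (1 < size (nbrs i))%N ->
  if wraps (i, j) then direction i (ccw i j) < direction i j
  else direction i j < direction i (ccw i j).
Proof. by move=> eij deg; apply: next_key_lt; rewrite ?mem_nbrs ?nbrs_sorted. Qed.

Lemma ccw_neq i j : e i j -> (1 < size (nbrs i))%N -> ccw i j != j.
Proof.
by move=> eij deg; apply: contraTneq (direction_ccw eij deg) => ->; rewrite ltxx if_same.
Qed.

Lemma corner_angle_bounds d : dart d -> (1 < size (nbrs d.1))%N ->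
  0 < corner_angle d < pi *+ 2.
Proof.
case: d => i j eij deg; have := direction_ccw eij deg; rewrite /corner_angle /=.
have := direction_bounds i j; have := direction_bounds i (ccw i j).
case: (wraps (i, j)); rewrite ?mul1r ?mul0r /= => /andP[? ?] /andP[? ?] ?;
  by apply/andP; split; lra.
Qed.

Lemma cos_corner_angle i j : e i j ->
  edist (pos i) (pos j) * edist (pos i) (pos (ccw i j)) * cos (corner_angle (i, j)) =
  dot (pos j - pos i) (pos (ccw i j) - pos i).
Proof.
move=> eij; have eik : e i (ccw i j) by rewrite ccw_adj.
have -> : cos (corner_angle (i, j)) = cos (direction i (ccw i j) - direction i j).
  by rewrite /corner_angle /=; case: (wraps _); rewrite ?mul1r ?mul0r ?addr0 ?cosD2pi.
have [xj yj] := edge_vector eij; have [xk yk] := edge_vector eik.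
by rewrite /dot /= xj yj xk yk cosB; ring.
Qed.

Lemma sin_corner_angle i j : e i j ->
  edist (pos i) (pos j) * edist (pos i) (pos (ccw i j)) * sin (corner_angle (i, j)) =
  cross (pos j - pos i) (pos (ccw i j) - pos i).
Proof.
move=> eij; have eik : e i (ccw i j) by rewrite ccw_adj.
have -> : sin (corner_angle (i, j)) = sin (direction i (ccw i j) - direction i j).
  by rewrite /corner_angle /=; case: (wraps _); rewrite ?mul1r ?mul0r ?addr0 ?sinD2pi.
have [xj yj] := edge_vector eij; have [xk yk] := edge_vector eik.
by rewrite /cross /= xj yj xk yk sinB; ring.
Qed.

Lemma vertex_angle_sum i : nbrs i != [::] ->
  \sum_(j <- nbrs i) corner_angle (i, j) = pi *+ 2.
Proof.
move=> nbrs0; rewrite big_split sumrB /= -mulr_suml.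
have -> : \sum_(j <- nbrs i) direction i (ccw i j) = \sum_(j <- nbrs i) direction i j.
  rewrite -(big_map (ccw i) xpredT (direction i)); apply: perm_big.
  apply: uniq_perm; rewrite ?map_inj_uniq ?nbrs_uniq //; first exact: ccw_inj.
  move=> j; apply/mapP/idP => [[k + ->]|ji]; first by rewrite mem_next.
  by exists (prev (nbrs i) j); rewrite ?mem_prev // /ccw next_prev ?nbrs_uniq.
rewrite subrr add0r sum_count /wraps /= (count_uniq_mem _ (nbrs_uniq i)).
by rewrite last_in // mul1r.
Qed.

Definition darts := [seq (i, j) | i <- index_iota 0 n.+1, j <- nbrs i].

Lemma mem_darts d : (d \in darts) = dart d.
Proof.
apply/allpairsPdep/idP => [[i [j [_]]]|ed]; first by rewrite mem_nbrs => eij ->.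
exists d.1, d.2; rewrite mem_nbrs mem_index_iota -surjective_pairing; split=> //.
by have [] := adj_le_both drawn ed.
Qed.

Lemma darts_uniq : uniq darts.
Proof.
apply: allpairs_uniq_dep => [|i _|]; [exact: iota_uniq|exact: nbrs_uniq|].
by move=> [i j] [i' j'] _ _ [/= -> ->].
Qed.

Lemma sum_darts (F : nat * nat -> R) :
  \sum_(d <- darts) F d = \sum_(0 <= i < n.+1) \sum_(j <- nbrs i) F (i, j).
Proof. by rewrite big_allpairs_dep. Qed.

Lemma count_darts (A : pred (nat * nat)) :
  count A darts = (\sum_(0 <= i < n.+1) count (fun j => A (i, j)) (nbrs i))%N.
Proof.
rewrite -sum1_count big_mkcond big_allpairs_dep; apply: eq_bigr => i _.
by rewrite -big_mkcond sum1_count.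
Qed.

(* For the darts of a single face this is its turning number. *)
Definition dart_turning (ds : seq (nat * nat)) : int :=
  (count rightward ds)%:Z - (count wraps ds)%:Z.

Definition label_class (lab : nat * nat -> nat) c := [seq d <- darts | lab d == c].

Section DartLabel.
Variable lab : labelling (nat * nat)%type.

Definition dart_label d :=
  if rightward d then upper lab d else lower lab (d.2, d.1).

Lemma nbrs_chain i :
  vertex_consistent (ending_edges n pos e) (starting_edges n pos e) lab i ->
  chain (fun j => dart_label (j, i)) (fun j => dart_label (i, j))
    (above lab i) (nbrs i) (above lab i).
Proof.
rewrite /vertex_consistent /lchain !chain_map => /andP[/chain_rev + startC].
rewrite revK => endC; apply/chain_cat; exists (below lab i).
  move: endC; congr (is_true _); apply: eq_in_chain => j;
    by rewrite (mem_nbrs_where drawn) /dart_label /rightward /= => /andP[_ ji];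
      rewrite ?ji // ltnNge ltnW.
move: startC; congr (is_true _); apply: eq_in_chain => j;
  by rewrite (mem_nbrs_where drawn) /dart_label /rightward /= => /andP[_ ij];
    rewrite ?ij // ltnNge ltnW.
Qed.

Hypothesis lab_ok : consistent (ending_edges n pos e) (starting_edges n pos e) lab n.+1.

Lemma dart_label_face_pred d : dart d -> dart_label (face_pred d) = dart_label d.
Proof.
case: d => i j eij; have [iln _] := adj_le_both drawn eij.
by apply: (chain_next (nbrs_uniq i) (nbrs_chain (lab_ok iln))); rewrite mem_nbrs.
Qed.

Lemma count_rightward_label i c :
  count (fun j => rightward (i, j) && (dart_label (i, j) == c)) (nbrs i) =
  count_mem c [seq upper lab p | p <- starting_edges n pos e i].
Proof.
rewrite /nbrs count_cat -[RHS]add0n; congr addn; last first.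
  rewrite -map_comp count_map; apply: eq_in_count => j.
  by rewrite (mem_nbrs_where drawn) /dart_label /rightward /= => /andP[_ ->].
apply/eqP; rewrite -leqn0 leqNgt -has_count; apply/hasPn => j.
by rewrite (mem_nbrs_where drawn) /rightward /= => /andP[_ ji]; rewrite ltnNge ltnW.
Qed.

Lemma count_wraps_label i c : (i <= n)%N -> nbrs i != [::] ->
  count (fun j => wraps (i, j) && (dart_label (i, j) == c)) (nbrs i) = (above lab i == c).
Proof.
move=> iln nbrs0; rewrite -(chain_last 0%N nbrs0 (nbrs_chain (lab_ok iln))) /wraps /=.
have := last_in 0%N nbrs0; set m := last _ _ => mi.
rewrite (eq_count (a2 := [pred j | (dart_label (i, m) == c) && (j == m)])); last first.
  by move=> j /=; case: (eqVneq j m) => [->|]; rewrite ?andbT ?andbF.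
case: (_ == c) => /=; last by rewrite count_pred0.
by rewrite (count_uniq_mem _ (nbrs_uniq i)) mi.
Qed.

Lemma dart_turning_label c : (forall i, (i <= n)%N -> nbrs i != [::]) ->
  dart_turning (label_class dart_label c) = turning (starting_edges n pos e) lab n.+1 c.
Proof.
move=> nbrs0; rewrite /dart_turning !count_filter !count_darts /turning.
rewrite !(big_morph Posz PoszD erefl) -sumrB; apply: eq_big_nat => i /andP[_ iln].
by rewrite count_rightward_label count_wraps_label ?nbrs0.
Qed.

End DartLabel.

Lemma dart_labelling : (forall i, (i <= n)%N -> nbrs i != [::]) ->
  exists lab : nat * nat -> nat, (forall d, dart d -> lab (face_pred d) = lab d) /\
  forall c, dart_turning (label_class lab c) <= if c == 0%N then -1 else 1.
Proof.
move=> nbrs0; have [lab [lab_ok lab_turning]] := drawing_labelling drawn.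
exists (dart_label lab); split; first exact: dart_label_face_pred.
by move=> c; rewrite dart_turning_label.
Qed.

Definition excess d : R := 3 / pi * corner_angle d - 1.
Definition gift d : R := clamp01 (excess d).
Definition small d := corner_angle d < pi / 3.

Lemma small_excess d : small d = (excess d < 0).
Proof.
by rewrite /small /excess subr_lt0 -ltr_pdivlMl ?divr_gt0 ?pi_gt0 // invf_div mulr1.
Qed.

Lemma vertex_excess_sum i : nbrs i != [::] ->
  \sum_(j <- nbrs i) excess (i, j) = 6 - (size (nbrs i))%:R.
Proof.
move=> nbrs0; rewrite sumrB -mulr_sumr vertex_angle_sum // sumr1_size mulr2n.
by have := lt0r_neq0 (pi_gt0 R); move: (@pi R) => p p0; field.
Qed.

Lemma sum_gift_le (ds : seq (nat * nat)) :
  \sum_(d <- ds) gift d <= (size ds)%:R - (count small ds)%:R.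
Proof.
elim: ds => [|d ds IH]; rewrite ?big_nil ?subr0 // big_cons /= small_excess.
rewrite -[(size ds).+1]addn1 !natrD /gift; have := clamp01_le1 (excess d).
by case: ltP => /= [/ltW/clamp01_eq0->|_]; lra.
Qed.

Section UnitEdges.
Variable l : R.
Hypothesis edge_length : forall i j, e i j -> edist (pos i) (pos j) = l.
Hypothesis deg_gt1 : forall i, (i <= n)%N -> (1 < size (nbrs i))%N.

Lemma dart_deg_gt1 d : dart d -> (1 < size (nbrs d.1))%N.
Proof. by move=> ed; apply: deg_gt1; have [] := adj_le_both drawn ed. Qed.

Lemma edge_length_gt0 i j : e i j -> 0 < l.
Proof.
move=> eij; rewrite -(edge_length eij); apply: edist_gt0 => pos_ij.
by have := sub_abscissa_neq0 drawn eij; rewrite pos_ij subrr eqxx.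
Qed.

Lemma face_pred_neq d : dart d -> face_pred d != d.
Proof.
by case: d => i j /(adj_neq drawn) ij; apply: contraNneq ij => -[_ ->].
Qed.

Lemma face_pred_iter2_neq d : dart d -> iter 2 face_pred d != d.
Proof.
by case: d => i j eij; apply: contraNneq (ccw_neq eij (dart_deg_gt1 eij)) => -[_ ->].
Qed.

Lemma small_face_pred_iter3_neq d : dart d -> small d -> iter 3 face_pred d != d.
Proof.
case: d => i j eij d_small; apply/eqP => -[_ /=]; set k := ccw i j => kiE.
have eik : e i k by rewrite ccw_adj.
have ejk : e j k by rewrite (adj_sym drawn) -kiE ccw_adj (adj_sym drawn).
have /andP[angle_gt0 _] := corner_angle_bounds eij (dart_deg_gt1 eij).
have : 2^-1 < cos (corner_angle (i, j)) by apply: cos_gt_half; rewrite angle_gt0.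
have := cos_corner_angle eij; have := dot_polarization (pos i) (pos j) (pos k).
rewrite -/k !edge_length // => dotE cosE; rewrite ltNge => /negP; apply.
have l2 : 0 < l * l by rewrite mulr_gt0 // (edge_length_gt0 eij).
by rewrite -(ler_pM2l l2) cosE; lra.
Qed.

Lemma small_face_pred_uniq d : dart d -> small d -> uniq (traject face_pred d 4).
Proof.
move=> ed d_small; have := small_face_pred_iter3_neq ed d_small.
have := face_pred_iter2_neq ed; have := face_pred_neq ed.
by rewrite /= !inE !negb_or !(inj_eq face_pred_inj) ![_ == d]eq_sym => -> -> ->.
Qed.

Lemma small_face_pred_loop d : dart d -> small d ->
  iter 4 face_pred d \in traject face_pred d 4 -> iter 4 face_pred d = d.
Proof.
move=> ed d_small; have := small_face_pred_iter3_neq ed d_small.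
have := face_pred_iter2_neq ed; have := face_pred_neq ed.
rewrite /= !inE !(inj_eq face_pred_inj) => /negPf -> /negPf -> /negPf ->.
by rewrite !orbF => /eqP.
Qed.

Lemma small_rhombus d : dart d -> small d ->
  iter 4 face_pred d = d -> small (iter 2 face_pred d).
Proof.
case: d => i j eij d_small [_ /=]; set k := ccw i j; set m := ccw k i => mkE.
have eik : e i k by rewrite ccw_adj.
have ekm : e k m by rewrite ccw_adj (adj_sym drawn).
have emj : e m j by rewrite -mkE ccw_adj (adj_sym drawn).
have emk : e m k by rewrite (adj_sym drawn).
have pos_neq a b : (a <= n)%N -> (b <= n)%N -> a != b -> pos a <> pos b.
  by move=> an bn /eqP ab /(congr1 fst)/(abscissa_inj drawn an bn)/ab.
have [[iln jln] [mln kln]] := (adj_le_both drawn eij, adj_le_both drawn emk).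
have rhombus : pos i + pos m = pos j + pos k.
  apply: (@rhombus_parallelogram _ _ _ _ _ l); rewrite ?edge_length //; apply: pos_neq => //.
    by rewrite eq_sym ccw_neq ?deg_gt1 // (adj_sym drawn).
  by rewrite eq_sym ccw_neq ?deg_gt1.
have angle_bounds d : dart d -> 0 <= corner_angle d < pi *+ 2.
  by move=> ed; have /andP[/ltW -> ->] := corner_angle_bounds ed (dart_deg_gt1 ed).
suff : corner_angle (m, k) = corner_angle (i, j) by rewrite /small /= -/k -/m => ->.
have l2 : l * l != 0 by rewrite mulf_neq0 // gt_eqF // (edge_length_gt0 eij).
apply: cos_sin_inj; rewrite ?angle_bounds //; apply: (mulfI l2).
  have := cos_corner_angle emk; have := cos_corner_angle eij.
  by rewrite mkE -/k !edge_length // => -> ->; apply: dot_parallelogram.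
have := sin_corner_angle emk; have := sin_corner_angle eij.
by rewrite mkE -/k !edge_length // => -> ->; apply: cross_parallelogram.
Qed.

(* The darts of a face satisfy these hypotheses, and so do those of a union of faces. *)
Section FaceClosed.
Variable ds : seq (nat * nat).
Hypothesis ds_uniq : uniq ds.
Hypothesis ds_dart : {in ds, forall d, dart d}.
Hypothesis ds_closed : {in ds, forall d, face_pred d \in ds}.

Lemma sum_face_pred (F : nat * nat -> R) :
  \sum_(d <- ds) F (face_pred d) = \sum_(d <- ds) F d.
Proof.
rewrite -(big_map face_pred xpredT F); apply/perm_big.
have map_uniq : uniq (map face_pred ds) by rewrite (map_inj_uniq face_pred_inj).
have sub : {subset map face_pred ds <= ds} by move=> _ /mapP[d dd ->]; apply: ds_closed.
by apply: uniq_perm => //; have [] := uniq_min_size map_uniq sub; rewrite ?size_map.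
Qed.

Lemma face_angle_sum : \sum_(d <- ds) corner_angle d =
  pi * ((size ds)%:R - 2 * (dart_turning ds)%:~R).
Proof.
pose F d := direction d.1 d.2 + pi * (1 - 2 * (rightward d)%:R).
have angleE d : d \in ds ->
    corner_angle d = F (face_pred d) - direction d.1 d.2 + 2 * pi * (wraps d)%:R.
  case: d => i j /ds_dart eij; have /(adj_neq drawn) ik : e i (ccw i j) by rewrite ccw_adj.
  by rewrite /corner_angle /F /rightward /= direction_rev //; ring.
rewrite big_seq (eq_bigr _ angleE) -big_seq big_split /= sumrB sum_face_pred.
rewrite big_split /= -!mulr_sumr sumrB -mulr_sumr !sum_count sumr1_size.
by rewrite /dart_turning intrB; ring.
Qed.

Lemma face_excess_sum : \sum_(d <- ds) excess d =
  2 * (size ds)%:R - 6 * (dart_turning ds)%:~R.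
Proof.
rewrite sumrB -mulr_sumr face_angle_sum sumr1_size.
by have := lt0r_neq0 (pi_gt0 R); move: (@pi R) => p p0; field.
Qed.

Lemma face_iter k d : d \in ds -> iter k face_pred d \in ds.
Proof. by move=> dd; elim: k => //= k; apply: ds_closed. Qed.

Lemma size_small_face d : d \in ds -> small d -> (6 <= size ds + count small ds)%N.
Proof.
move=> dd d_small; have ed := ds_dart dd; pose walk := traject face_pred d 4.
have walk_uniq : uniq walk by apply: small_face_pred_uniq.
have walk_sub : {subset walk <= ds} by move=> _ /trajectP[k _ ->]; apply: face_iter.
have := uniq_leq_size walk_uniq walk_sub; rewrite leq_eqVlt => /orP[/eqP size4|size5].
  have closes : iter 4 face_pred d = d.
    have [_ walk_ds] := uniq_min_size walk_uniq walk_sub (eq_leq (esym size4)).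
    by apply: small_face_pred_loop => //; rewrite walk_ds face_iter.
  rewrite -size4 size_traject -size_filter -[6%N]/(4 + 2)%N leq_add2l.
  apply: (@uniq_leq_size _ [:: d; iter 2 face_pred d]).
    by rewrite /= inE eq_sym face_pred_iter2_neq.
  move=> z; rewrite !inE => /orP[] /eqP->; rewrite mem_filter ?d_small // face_iter // andbT.
  exact: small_rhombus.
have small_pos : (0 < count small ds)%N by rewrite -has_count; apply/hasP; exists d.
exact: leq_add size5 small_pos.
Qed.

Lemma face_gift_le : dart_turning ds <= 1 ->
  \sum_(d <- ds) gift d <= \sum_(d <- ds) excess d.
Proof.
move=> turning_le; have [/hasP[d dd d_small]|/hasPn not_small] := boolP (has small ds).
  apply: le_trans (sum_gift_le ds) _; rewrite face_excess_sum.
  have := size_small_face dd d_small; rewrite -(ler_nat R) natrD.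
  by move: turning_le; rewrite -(ler_int R); lra.
rewrite big_seq [leRHS]big_seq; apply: ler_sum => d /not_small.
by rewrite small_excess -leNgt; apply: clamp01_le.
Qed.

Lemma face_gift_lt : dart_turning ds <= -1 ->
  \sum_(d <- ds) gift d < \sum_(d <- ds) excess d.
Proof.
move=> turning_le; apply: le_lt_trans (sum_gift_le ds) _; rewrite face_excess_sum.
have := ler0n R (size ds); have := ler0n R (count small ds).
by move: turning_le; rewrite -(ler_int R); lra.
Qed.

End FaceClosed.

Lemma sum_gift_lt_excess : \sum_(d <- darts) gift d < \sum_(d <- darts) excess d.
Proof.
have nbrs0 i : (i <= n)%N -> nbrs i != [::].
  by move=> /deg_gt1; case: (nbrs i).
have [lab [lab_face turning_le]] := dart_labelling nbrs0.
pose M := (\max_(d <- darts) lab d).+1.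
have labM : {in darts, forall d, (lab d < M)%N}.
  by move=> d dd; rewrite ltnS; apply: leq_bigmax_seq.
have class_uniq c : uniq (label_class lab c) := filter_uniq _ darts_uniq.
have class_dart c : {in label_class lab c, forall d, dart d}.
  by move=> d; rewrite mem_filter mem_darts => /andP[].
have class_closed c : {in label_class lab c, forall d, face_pred d \in label_class lab c}.
  move=> d; rewrite !mem_filter !mem_darts dart_face_pred => /andP[/eqP <- ed].
  by rewrite lab_face // eqxx ed.
rewrite !(sum_by_label _ labM) !big_ord_recl /= ltr_leD //.
  exact: (face_gift_lt (class_uniq _) (@class_dart 0%N) (@class_closed _) (turning_le _)).
by apply: ler_sum => c _; apply: (face_gift_le (class_uniq _) (@class_dart (lift ord0 c))
  (@class_closed _) (turning_le _)).
Qed.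

End UnitEdges.

Lemma no_unit_drawing_min_degree5 l : (forall i j, e i j -> edist (pos i) (pos j) = l) ->
  ~ (forall i, (i <= n)%N -> (5 <= size (nbrs i))%N).
Proof.
move=> edge_length deg5.
have deg_gt1 i : (i <= n)%N -> (1 < size (nbrs i))%N by move=> /deg5; lia.
have := sum_gift_lt_excess edge_length deg_gt1; apply/negP; rewrite -leNgt !sum_darts.
apply: ler_sum_nat => i /andP[_ iln]; apply: sum_clamp01_ge.
have deg := deg5 i iln; rewrite vertex_excess_sum; last by rewrite -size_eq0; lia.
by rewrite lerBlDl -lerBlDr; move: deg; rewrite -(ler_nat R); lra.
Qed.

End Corners.

(** * From planar maps to drawings *)

Section Segments.
Variable R : realType.
Local Open Scope classical_set_scope.
Local Open Scope ring_scope.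
Implicit Types (a b p q : plane R) (t u : R).

Lemma seg_point0 a b : seg_point a b 0 = a.
Proof. by rewrite /seg_point subr0 !mul1r !mul0r !addr0 -surjective_pairing. Qed.

Lemma seg_pointC a b t : seg_point a b t = seg_point b a (1 - t).
Proof. by rewrite /seg_point; congr pair; ring. Qed.

Lemma seg_point1 a b : seg_point a b 1 = b.
Proof. by rewrite seg_pointC subrr seg_point0. Qed.

Lemma seg_point_id a t : seg_point a a t = a.
Proof. by rewrite [RHS]surjective_pairing /seg_point; congr pair; ring. Qed.

Lemma seg_point_eq_left a b t : seg_point a b t = a -> a = b \/ t = 0.
Proof.
case: a b => [a1 a2] [b1 b2] [eq1 eq2].
have [->|t0] := eqVneq t 0; [by right|left].
by congr pair; apply: (mulfI t0); lra.
Qed.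

Lemma segment_left a b : segment a b a.
Proof. by exists 0; rewrite /= ?lexx ?ler01 // seg_point0. Qed.

Lemma segmentC a b : segment a b = segment b a.
Proof.
suff sub p q : segment p q `<=` segment q p by apply/seteqP; split; exact: sub.
move=> _ [t /= /andP[t0 t1] <-]; exists (1 - t); last by rewrite -seg_pointC.
by apply/andP; split; lra.
Qed.

Lemma segment_right a b : segment a b b.
Proof. by rewrite segmentC; exact: segment_left. Qed.

Lemma open_segmentW a b : open_segment a b `<=` segment a b.
Proof. by move=> _ [t /= /andP[/ltW t0 /ltW t1] <-]; exists t; rewrite //= t0. Qed.

Lemma segment_open_or_end a b p : segment a b p -> [\/ p = a, p = b | open_segment a b p].
Proof.
move=> [t /= /andP[+ +] <-]; rewrite le_eqVlt => /predU1P[<- _|t0].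
  by constructor 1; rewrite seg_point0.
rewrite le_eqVlt => /predU1P[->|t1]; first by constructor 2; rewrite seg_point1.
by constructor 3; exists t; rewrite /= ?t0.
Qed.

Lemma open_segment_not_end a b p q : a <> b -> segment a b = segment p q ->
  ~ open_segment a b p.
Proof.
move=> ab eq_seg [t /= /andP[t0 t1] p_t].
have := segment_left a b; rewrite eq_seg => -[u /= /andP[u0 u1] a_u].
have := segment_right a b; rewrite eq_seg => -[v /= /andP[v0 v1] b_v].
have [pq|w0] : p = q \/ (1 - t) * u + t * v = 0.
- apply: seg_point_eq_left; rewrite -[RHS]p_t -a_u -b_v /seg_point /=.
  by congr pair; ring.
- by apply: ab; rewrite -a_u -b_v pq !seg_point_id.
have tu : 0 <= (1 - t) * u by rewrite mulr_ge0 ?subr_ge0 // ltW.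
have tv : 0 <= t * v by rewrite mulr_ge0 // ltW.
have u_eq0 : u = 0 by apply: (mulfI (x := 1 - t)); [apply: lt0r_neq0; rewrite subr_gt0|lra].
have v_eq0 : v = 0 by apply: (mulfI (x := t)); [exact: lt0r_neq0|lra].
by apply: ab; rewrite -a_u -b_v u_eq0 v_eq0.
Qed.

Lemma segment_eq_end a b p q : a <> b -> segment a b = segment p q -> p = a \/ p = b.
Proof.
move=> ab eq_seg; have /segment_open_or_end[] : segment a b p; try by [left|right].
  by rewrite eq_seg; apply: segment_left.
by move=> /(open_segment_not_end ab eq_seg).
Qed.

Lemma segment_inj a : injective (segment a).
Proof.
move=> b c eq_seg; have [ab|ab] := pselect (a = b).
  have := segment_right a c; rewrite -eq_seg -ab => -[t _ <-].
  by rewrite seg_point_id.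
have [ca|//] := segment_eq_end ab (etrans eq_seg (segmentC a c)).
have := segment_right a b; rewrite eq_seg ca => -[t _ <-].
by rewrite seg_point_id.
Qed.

Lemma open_segment_graph a b z : a.1 < z < b.1 ->
  open_segment a b (z, a.2 + (b.2 - a.2) / (b.1 - a.1) * (z - a.1)).
Proof.
move=> /andP[az zb]; have d_gt0 : 0 < b.1 - a.1 by lra.
have dN0 := lt0r_neq0 d_gt0; exists ((z - a.1) / (b.1 - a.1)).
  by rewrite /= divr_gt0 ?ltr_pdivrMr // ?mul1r; lra.
by rewrite /seg_point; congr pair; field.
Qed.

(* A similarity; for generic t no two images of vertices have the same abscissa. *)
Definition skew t p : plane R := (p.1 + t * p.2, p.2 - t * p.1).

Lemma skew_seg_point t a b u : skew t (seg_point a b u) = seg_point (skew t a) (skew t b) u.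
Proof. by rewrite /skew /seg_point /=; congr pair; ring. Qed.

Lemma skew_inj t : injective (skew t).
Proof.
move=> [p1 p2] [q1 q2] [/= eq1 eq2]; have tN0 := lt0r_neq0 (add1_sqr_gt0 t).
congr pair; apply: (mulfI tN0).
  transitivity ((p1 + t * p2) - t * (p2 - t * p1)); first by ring.
  by rewrite eq1 eq2; ring.
transitivity ((p2 - t * p1) + t * (p1 + t * p2)); first by ring.
by rewrite eq1 eq2; ring.
Qed.

Lemma edist_skew t p q : edist (skew t p) (skew t q) = Num.sqrt (1 + t ^+ 2) * edist p q.
Proof.
by rewrite -sqrtrM ?ltW ?add1_sqr_gt0 // /edist /skew /=; congr Num.sqrt; ring.
Qed.

Lemma skew_open_segment t a b p : open_segment (skew t a) (skew t b) p ->
  exists2 q, open_segment a b q & skew t q = p.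
Proof.
by move=> [u u01 <-]; exists (seg_point a b u); rewrite ?skew_seg_point //; exists u.
Qed.

Lemma exists_notin (r : seq R) : exists t, t \notin r.
Proof.
have [t /allP r_le] : exists t, all (<=%R^~ t) r.
  elim: r => [|u r [t r_le]]; first by exists 0.
  exists (Num.max u t); rewrite /= le_max lexx; apply: sub_all r_le => v /= v_le.
  by rewrite le_max v_le orbT.
by exists (t + 1); apply/negP => /r_le /=; rewrite gerDl ler10.
Qed.

Lemma generic_skew (s : seq (plane R)) : exists t, {in s &, injective (fst \o skew t)}.
Proof.
have [t t_notin] := exists_notin [seq - (p.1 - q.1) / (p.2 - q.2) | p <- s, q <- s].
exists t => p q ps qs /= eq_x; have [eq2|neq2] := eqVneq p.2 q.2.
  by apply: (@skew_inj t); rewrite /skew eq_x; move: eq_x; rewrite eq2 => /addIr ->.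
case/negP: t_notin; apply/allpairsP; exists (p, q); split=> //=.
by apply: (mulIf (x := p.2 - q.2)); rewrite ?mulfVK ?subr_eq0 //; lra.
Qed.

End Segments.

Section Reduction.
Variables (R : realType) (V : set (plane R)) (E : set (set (plane R))).
Local Open Scope classical_set_scope.
Local Open Scope ring_scope.
Hypothesis planar : straight_planar_map V E.
Implicit Types a b c d p q : plane R.

Definition adjacent a b : Prop := a <> b /\ E (segment a b).

Lemma adjacentC a b : adjacent a b <-> adjacent b a.
Proof. by rewrite /adjacent segmentC; split=> -[/nesym]. Qed.

Lemma vertex_off_edge p a b : V p -> adjacent a b -> ~ open_segment a b p.
Proof.
move=> Vp [ab Eab] abp; case: planar => _ _ _ /(_ p _ Vp Eab); apply.
by exists a, b.
Qed.

Lemma vertex_on_edge p a b : V p -> adjacent a b -> segment a b p -> p = a \/ p = b.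
Proof.
move=> Vp adj /segment_open_or_end[]; [by left|by right|].
by move/(vertex_off_edge Vp adj).
Qed.

Lemma crossing_edges_eq a b c d p : V c -> V d -> adjacent a b -> adjacent c d ->
  open_segment a b p -> open_segment c d p -> (a = c /\ b = d) \/ (a = d /\ b = c).
Proof.
move=> Vc Vd adj_ab adj_cd abp cdp; have [[ab Eab] [cd Ecd]] := (adj_ab, adj_cd).
have [eq_seg|neq_seg] := pselect (segment a b = segment c d).
  have := vertex_on_edge Vc adj_ab; rewrite eq_seg => /(_ (segment_left c d)) c_end.
  have := vertex_on_edge Vd adj_ab; rewrite eq_seg => /(_ (segment_right c d)) d_end.
  by case: c_end d_end cd => -> [] ->; [|left|right|].
case: planar => _ _ /(_ _ _ Eab Ecd neq_seg) [_ ends] _.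
have [|[q [_ eq_seg]] _] := ends p; first by split; apply: open_segmentW.
by case: (open_segment_not_end ab eq_seg abp).
Qed.

Lemma endpoint_adjacent p s : V p -> E s -> endpoint p s ->
  exists q, [/\ V q, adjacent p q & s = segment p q].
Proof.
move=> Vp Es [q [_ s_pq]].
have [a [b [Va Vb [ab s_ab]]]] : exists a b, [/\ V a, V b & joins s a b].
  by case: planar => _ /(_ _ Es).
have adj : adjacent a b by split; rewrite -?s_ab.
have [pa|pb] : p = a \/ p = b.
- by apply: vertex_on_edge => //; rewrite -s_ab s_pq; apply: segment_left.
- by exists b; rewrite pa.
- by exists a; rewrite pb segmentC; split=> //; apply/adjacentC.
Qed.

Lemma count_adjacent p (s : seq (plane R)) k : V = [set` s] -> uniq s -> V p ->
  ([set t | E t /\ endpoint p t] #= `I_k)%card ->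
  count (fun q => `[< adjacent p q >]) s = k.
Proof.
move=> Vs us Vp; rewrite -size_filter; set nb := seq.filter _ s.
have nb_uniq : uniq nb by rewrite filter_uniq.
have -> : [set t | E t /\ endpoint p t] = (fun i => segment p (nth p nb i)) @` `I_(size nb).
  apply/seteqP; split=> [t [Et /(endpoint_adjacent Vp Et)[q [Vq adj ->]]]|_ [i i_lt <-]].
    have q_nb : q \in nb.
      by rewrite mem_filter; apply/andP; split; [exact/asboolP|move: Vq; rewrite Vs].
    by exists (index q nb); rewrite /= ?index_mem // nth_index.
  have := mem_nth p i_lt; rewrite mem_filter => /andP[/asboolP[pq Epq] _].
  by split=> //; exists (nth p nb i).
move=> card_k; apply/card_eq_II; apply: card_eq_trans card_k.
rewrite card_eq_sym; apply: inj_card_eq => i j; rewrite !inE /= => i_lt j_lt.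
by move=> /segment_inj/eqP; rewrite nth_uniq // => /eqP.
Qed.

Section SortedVertices.
Variables (t : R) (s : seq (plane R)) (p0 : plane R).
Hypothesis V_s : V = [set` s].
Hypothesis s_sorted : sorted (key_lt (fst \o skew t)) s.

Let pt i := nth p0 s i.
Let pos i := skew t (pt i).

Definition adj_index i j :=
  [&& (i < size s)%N, (j < size s)%N & `[< adjacent (pt i) (pt j) >]].

Lemma pt_vertex i : (i < size s)%N -> V (pt i).
Proof. by move=> i_lt; rewrite V_s /=; apply: mem_nth. Qed.

Lemma pt_inj i j : (i < size s)%N -> (j < size s)%N -> pt i = pt j -> i = j.
Proof.
by move=> i_lt j_lt /eqP; rewrite nth_uniq ?(key_lt_sorted_uniq s_sorted) // => /eqP.
Qed.

Lemma pt_abscissa_lt i j : (i < j < size s)%N -> (pos i).1 < (pos j).1.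
Proof.
move=> /andP[ij j_lt]; apply: (sorted_ltn_nth (@key_lt_trans _ _ _ _) p0 s_sorted) => //.
by rewrite inE (ltn_trans ij).
Qed.

Lemma is_edge_adjacent e : is_edge adj_index e ->
  [/\ (e.1 < e.2 < size s)%N, V (pt e.1), V (pt e.2) & adjacent (pt e.1) (pt e.2)].
Proof.
by move=> /andP[/and3P[lt1 lt2 /asboolP adj] ->]; split=> //; apply: pt_vertex.
Qed.

Lemma height_open_segment e z : strictly_over pos e z ->
  exists2 p, open_segment (pt e.1) (pt e.2) p & skew t p = (z, height pos e z).
Proof. by move=> over; apply/skew_open_segment/open_segment_graph. Qed.

Lemma adj_index_noncrossing e f z :
  is_edge adj_index e -> is_edge adj_index f -> e != f ->
  strictly_over pos e z -> strictly_over pos f z -> height pos e z != height pos f z.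
Proof.
move=> /is_edge_adjacent[/andP[e12 e2] Ve1 Ve2 adj_e].
move=> /is_edge_adjacent[/andP[f12 f2] Vf1 Vf2 adj_f] ef.
move=> /height_open_segment[p ep skew_p] /height_open_segment[q fq skew_q].
apply: contraNneq ef => eq_height; have pq : p = q.
  by apply: (@skew_inj R t); rewrite skew_p skew_q eq_height.
have [e1 f1] := (ltn_trans e12 e2, ltn_trans f12 f2); rewrite -pq in fq.
case: (crossing_edges_eq Vf1 Vf2 adj_e adj_f ep fq) => -[/pt_inj ef1 /pt_inj ef2].
  by rewrite -pair_eqE /pair_eq /= (ef1 e1 f1) (ef2 e2 f2) !eqxx.
by move: e12; rewrite (ef1 e1 f2) (ef2 e2 f1) ltnNge ltnW.
Qed.

Lemma adj_index_off_vertices e k : is_edge adj_index e -> (e.1 < k < e.2)%N ->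
  height pos e (pos k).1 != (pos k).2.
Proof.
move=> /is_edge_adjacent[/andP[e12 e2] Ve1 Ve2 adj_e] /andP[e1k ke2].
have k_lt : (k < size s)%N := ltn_trans ke2 e2.
have over : strictly_over pos e (pos k).1 by rewrite /strictly_over !pt_abscissa_lt ?e1k ?ke2.
have [p ep skew_p] := height_open_segment over; apply/eqP => height_k.
apply: (vertex_off_edge (pt_vertex k_lt) adj_e).
suff <- : p = pt k by [].
by apply: (@skew_inj R t); rewrite skew_p height_k -surjective_pairing.
Qed.

Lemma sorted_drawing : (0 < size s)%N -> drawing (size s).-1 pos adj_index.
Proof.
move=> s_pos; have le_size i : (i <= (size s).-1)%N = (i < size s)%N by rewrite -ltnS prednK.
split.
- move=> i j; rewrite /adj_index andbCA; do 2!congr andb.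
  by apply: asbool_equiv_eq; exact: adjacentC.
- by move=> i; apply/negP => /and3P[_ _ /asboolP[]].
- by move=> i j /and3P[i_lt _ _]; rewrite le_size.
- by move=> i j; rewrite le_size; apply: pt_abscissa_lt.
- exact: adj_index_noncrossing.
- exact: adj_index_off_vertices.
Qed.

Lemma count_adj_index (d : nat) i : regular_of_degree d V E -> (i < size s)%N ->
  count (adj_index i) (iota 0 (size s)) = d.
Proof.
move=> reg i_lt; have Vi := pt_vertex i_lt.
rewrite -(count_adjacent V_s (key_lt_sorted_uniq s_sorted) Vi (reg _ Vi)).
rewrite -[in RHS](mkseq_nth p0 s) count_map.
by apply: eq_in_count => j; rewrite mem_iota /= add0n /adj_index i_lt => ->.
Qed.

End SortedVertices.

Lemma planar_map_drawing (d : nat) (l : R) : V !=set0 ->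
  (forall s a b, E s -> joins s a b -> edist a b = l) -> regular_of_degree d V E ->
  exists n (pos : nat -> plane R) e l', [/\ drawing n pos e,
    forall i j, e i j -> edist (pos i) (pos j) = l'
    & forall i, (i <= n)%N -> count (e i) (iota 0 n.+1) = d].
Proof.
move=> [p0 Vp0] edge_length reg.
have [s0 V_s0] : exists s0 : seq (plane R), V = [set` s0].
  by apply/finite_seqP; case: planar.
have [t t_inj] := generic_skew s0; pose s := sort_by (fst \o skew t) (undup s0).
have s_sorted : sorted (key_lt (fst \o skew t)) s.
  apply: sort_by_sorted; last exact: undup_uniq.
  by move=> p q; rewrite !mem_undup; apply: t_inj.
have V_s : V = [set` s].
  by rewrite V_s0; apply/seteqP; split=> p /=; rewrite mem_sort mem_undup.
have s_pos : (0 < size s)%N by move: Vp0; rewrite V_s /=; case: (s).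
exists (size s).-1, (fun i => skew t (nth p0 s i)), (adj_index s p0),
  (Num.sqrt (1 + t ^+ 2) * l); split=> [|i j|i].
- exact: sorted_drawing.
- move=> /and3P[_ _ /asboolP[ij Eij]].
  by rewrite edist_skew (edge_length _ _ _ Eij (conj ij erefl)).
- by rewrite -ltnS prednK //; exact: (count_adj_index p0 V_s s_sorted reg).
Qed.

End Reduction.

Local Open Scope classical_set_scope.

Theorem mainTheorem1 (R : realType) :
  ~ exists (V : set (plane R)) (E : set (set (plane R))),
      [/\ V !=set0,
          straight_planar_map V E,
          equal_edges E
        & regular_of_degree 5 V E].
Proof.
move=> [V [E [V0 planar [l edge_length] regular]]].
have [n [pos [e [l' [drawn unit_edges degree]]]]] :=
  planar_map_drawing planar V0 edge_length regular.
apply: (no_unit_drawing_min_degree5 drawn unit_edges) => i iln.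
by rewrite (size_nbrs drawn) degree.
Qed.
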